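(* Let $p\ge 1$ be an integer, let $N_1,N_2$ be two independent standard normal vectors in $\mathbb{R}^p$, put $R_1=|N_1|$, $R_2=|N_2|$, $R_3=|N_1+N_2|$, and let $\mu_{R_3|(R_1,R_2)}$ be a regular version of the conditional distribution of $R_3$ given $(R_1,R_2)$. Then for every $v\in\mathbb{R}^p$, almost surely, $$j_{(p/2)-1}(|v|R_1)\,j_{(p/2)-1}(|v|R_2)=\int_{\mathbb{R}_+} j_{(p/2)-1}(|v|\xi)\,\mu_{R_3|(R_1,R_2)}(d\xi).$$ Consequently, for all real numbers $x,z\ge 0$ there is a compactly supported probability distribution $\tau_{x,z}^{(p/2)-1}$ on $\mathbb{R}_+$ such that for all $y\ge 0$ $$j_{(p/2)-1}(xy)\,j_{(p/2)-1}(zy)=\int_{\mathbb{R}_+} j_{(p/2)-1}(\xi y)\,\tau_{x,z}^{(p/2)-1}(d\xi),$$ and $(x,z)\mapsto \tau_{x,z}^{(p/2)-1}$ is a version of the conditional distribution of $R_3$ given $(R_1=x,R_2=z)$.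
   Context: For $\nu>-1$ and $z\in\mathbb{C}$, the spherical Bessel function of index $\nu$ is $j_\nu(z)=\sum_{l\ge 0}\frac{(-1)^l}{(\nu+1)_l\, l!}\left(\frac z2\right)^{2l}$, where $(\nu+1)_l=\Gamma(\nu+l+1)/\Gamma(\nu+1)$. $|\cdot|$ is the Euclidean norm on $\mathbb{R}^p$, and $\mathbb{R}_+=[0,\infty)$. A standard normal vector in $\mathbb{R}^p$ has independent centered normal coordinates of unit variance. All random variables are defined on a common probability space. *)

(* Defs.v *)
From HB Require Import structures.
From mathcomp Require Import all_boot all_order all_algebra.
From mathcomp Require Import all_classical all_reals all_analysis.

Set Implicit Arguments.
Unset Strict Implicit.
Unset Printing Implicit Defensive.

Import Order.TTheory GRing.Theory Num.Theory.
Import numFieldNormedType.Exports.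

Local Open Scope classical_set_scope.
Local Open Scope ring_scope.

Section special_functions.
Context {R : realType}.

(* Euler's integral; meaningful for x > 0. *)
Definition Gamma (x : R) : R :=
  \int[lebesgue_measure]_(t in `]0, +oo[) (t `^ (x - 1) * expR (- t)).

Definition pochhammer (a : R) (l : nat) : R := Gamma (a + l%:R) / Gamma a.

(* The spherical Bessel function of index nu > -1, restricted to real
   arguments. *)
Definition sphBessel (nu z : R) : R :=
  limn (series (fun l : nat =>
    (-1) ^+ l / (pochhammer (nu + 1) l * l`!%:R) * (z / 2) ^+ l.*2)).

End special_functions.

(* Vectors of R^p are p-tuples, whose sigma-algebra is the one generated by
   the coordinates. *)
Section vectors.
Context {R : realType} {p : nat}.

Definition tupleD (x y : p.-tuple R) : p.-tuple R :=
  [tuple tnth x i + tnth y i | i < p].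

Definition enorm (x : p.-tuple R) : R :=
  Num.sqrt (\sum_(i < p) tnth x i ^+ 2).

End vectors.

Section probability_notions.
Local Open Scope ereal_scope.
Context d (T : measurableType d) (R : realType) (P : probability T R).

Definition independent2 d1 d2 (T1 : measurableType d1) (T2 : measurableType d2)
    (X : {RV P >-> T1}) (Y : {RV P >-> T2}) : Prop :=
  forall A B, measurable A -> measurable B ->
    P (X @^-1` A `&` Y @^-1` B) = P (X @^-1` A) * P (Y @^-1` B).

Definition mutually_independent (I : finType) d1 (T1 : measurableType d1)
    (X : I -> T -> T1) : Prop :=
  forall (J : {set I}) (A : I -> set T1), (forall i, measurable (A i)) ->
    P (\bigcap_(i in [set` J]) (X i @^-1` A i)) =
    \prod_(i in J) P (X i @^-1` A i).

(* The second parameter of normal_prob is the standard deviation. *)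
Definition standard_normal_vector (p : nat) (N : {RV P >-> p.-tuple R}) : Prop :=
  let coord (i : 'I_p) (w : T) : R := tnth (N w) i in
  mutually_independent coord /\
  forall (i : 'I_p) (A : set R), measurable A ->
    pushforward P (coord i) A = normal_prob 0%R 1%R A.

(* k is a regular version of the conditional distribution of Y given X: for
   each measurable B, k (X w) B is a version of P(Y \in B | X), the events of
   the sigma-algebra generated by X being the preimages of measurable sets. *)
Definition regular_cond_distribution d1 d2 (T1 : measurableType d1)
    (T2 : measurableType d2) (X : T -> T1) (Y : T -> T2)
    (k : R.-pker T1 ~> T2) : Prop :=
  forall A B, measurable A -> measurable B ->
    P (X @^-1` A `&` Y @^-1` B) = \int[P]_(w in X @^-1` A) k (X w) B.

End probability_notions.

Definition compactly_supported {R : realType}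
    (m : {measure set R -> \bar R}) : Prop :=
  exists2 K : set R, compact K & m (~` K) = 0%E.

(* Main.v *)
Require Import Defs.
From HB Require Import structures.
From mathcomp Require Import all_boot all_order all_algebra.
From mathcomp Require Import zify ring lra.
From mathcomp Require Import all_classical all_reals all_analysis.
From mathcomp Require Import measurable_realfun.
Import Order.TTheory GRing.Theory Num.Theory.
Import numFieldNormedType.Exports.
Local Open Scope classical_set_scope.
Local Open Scope ring_scope.

(** Write N1 = R1 e1 and N2 = R2 e2 with unit vectors e1, e2, and let U be the
cosine of the angle between N1 and N2. The law of cosines gives
R3 ^ 2 = R1 ^ 2 + R2 ^ 2 + 2 R1 R2 U. The whole statement follows from three facts.

The first is that U is independent of (R1, R2) (lemma integral_bipolar). A
function V of a Gaussian vector x which is invariant under positive scalings is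
independent of |x|: rescaling the Gaussian integral shows that the Laplace
transform of |x| ^ 2 / 2 on an event about V is P(V in C) times the one without
that event, and Laplace transforms determine laws (laplace_unique). Applied to
each of the two vectors in turn, this makes
tau(x, z) = law of sqrt(x ^ 2 + z ^ 2 + 2 x z U) a regular version of the
conditional distribution of R3 given (R1, R2) (chord_kernel_regular). It is
carried by [0, x + z].

The second is the value of the moments of U, with c = p / 2: the odd ones vanish
by symmetry, and E U ^ (2 m) = (1/2)_m / (c)_m is obtained by computing the
moments of the inner product of N1 and N2 in two ways (cosine_even_moment). The
moments of |x| ^ 2 and the recursion for Gamma at half-integers are both
instances of one lemma that differentiates a scaling identity
(moment_by_scaling).

The third is the product formula for every x, z >= 0 (bessel_product). Expanding
j(y sqrt(x ^ 2 + z ^ 2 + 2 x z U)) in powers of y and integrating term by term,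
one has to know E (x ^ 2 + z ^ 2 + 2 x z U) ^ l. By the moments of U and the
Chu-Vandermonde identity it is the sum over a + b = l of
binom(l, a) (c)_l / ((c)_a (c)_b) x ^ (2 a) z ^ (2 b), which is what the Cauchy
product of the series of j(x y) and j(z y) requires.

An arbitrary regular version of the conditional distribution agrees with tau
almost surely, as a measure (regular_cond_distribution_ae_eq); so the product
formula holds almost surely for it as well. *)

Set Implicit Arguments.
Unset Strict Implicit.

(** * Image measures, densities and Tonelli in curried form *)

Section image_measure.
Context d1 d2 (T1 : measurableType d1) (T2 : measurableType d2) (R : realType).

(** A bundled measure, where the canonical structure on [pushforward] is only
inferred once a proof of measurability is at hand. *)
Definition image_measure (mu : {measure set T1 -> \bar R}) (f : T1 -> T2)
    (mf : measurable_fun setT f) : {measure set T2 -> \bar R}.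
Proof.
pose mixin := isMeasurableFun.Build _ _ _ _ _ mf.
pose F : {mfun T1 >-> T2} := HB.pack f mixin.
by refine (pushforward mu F : {measure set T2 -> \bar R}) => //.
Defined.
Arguments image_measure mu [f] mf : simpl never.

Context (mu : {measure set T1 -> \bar R}) (f : T1 -> T2).
Context (mf : measurable_fun setT f).

Lemma image_measureE A : image_measure mu mf A = mu (f @^-1` A).
Proof. by []. Qed.

Lemma ge0_integral_image_measure (g : T2 -> \bar R) :
  measurable_fun setT g -> (forall y, 0 <= g y)%E ->
  (\int[image_measure mu mf]_y g y = \int[mu]_x g (f x))%E.
Proof. by move=> mg g0; rewrite ge0_integral_pushforward. Qed.

End image_measure.
Arguments image_measure {d1 d2 T1 T2 R} mu [f] mf.
Arguments image_measure : simpl never.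

Section image_probability.
Context d1 d2 (T1 : measurableType d1) (T2 : measurableType d2) (R : realType).

Definition image_prob (P : probability T1 R) (f : T1 -> T2)
    (mf : measurable_fun setT f) : probability T2 R :=
  let mixin := isMeasurableFun.Build _ _ _ _ _ mf in
  distribution P (HB.pack f mixin : {mfun T1 >-> T2}).

Context (P : probability T1 R) (f : T1 -> T2).
Context (mf : measurable_fun setT f).

Lemma ge0_integral_image_prob (g : T2 -> \bar R) :
  measurable_fun setT g -> (forall y, 0 <= g y)%E ->
  (\int[image_prob P mf]_y g y = \int[P]_x g (f x))%E.
Proof. by move=> mg g0; rewrite ge0_integral_distribution. Qed.

End image_probability.
Arguments image_prob {d1 d2 T1 T2 R} P [f] mf.
Arguments image_prob : simpl never.

Section curried_tonelli.
Local Open Scope ereal_scope.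
Context d1 d2 (T1 : measurableType d1) (T2 : measurableType d2) (R : realType).
Context (m1 : {sigma_finite_measure set T1 -> \bar R}).
Context (m2 : {sigma_finite_measure set T2 -> \bar R}).
Context (f : T1 -> T2 -> \bar R).
Hypothesis mf : measurable_fun [set: T1 * T2] (fun z => f z.1 z.2).
Hypothesis f0 : forall x y, 0 <= f x y.

Lemma measurable_integral_param : measurable_fun setT (fun x => \int[m2]_y f x y).
Proof. by apply: (measurable_fun_fubini_tonelli_F _ mf) => z; exact: f0. Qed.

Lemma tonelli_swap :
  \int[m1]_x \int[m2]_y f x y = \int[m2]_y \int[m1]_x f x y.
Proof. by apply: (fubini_tonelli _ mf) => z; exact: f0. Qed.

Lemma tonelli_prod :
  \int[m1 \x m2]_z f z.1 z.2 = \int[m1]_x \int[m2]_y f x y.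
Proof. by apply: (fubini_tonelli1 _ mf) => z; exact: f0. Qed.

End curried_tonelli.

Lemma integral_prob_cst d (T : measurableType d) (R : realType)
    (P : probability T R) (c : \bar R) : (\int[P]_x cst c x = c)%E.
Proof. by rewrite integral_cst// -[RHS]mule1; congr (_ * _)%E; exact: probability_setT. Qed.

(** The inverse of a nonnegative number is its power -1, also at 0 where both
vanish; powers are known to be measurable. *)
Lemma measurable_inv_ge0 d (T : measurableType d) (R : realType) (f : T -> R) :
  measurable_fun setT f -> (forall x, 0 <= f x) ->
  measurable_fun setT (fun x => (f x)^-1).
Proof.
move=> mf f0; rewrite (_ : (fun _ => _) = (fun t => t `^ (-1)) \o f).
  by apply: measurableT_comp => //; exact: measurable_powR.
by apply/funext => x /=; rewrite powR_inv1.
Qed.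

Section density.
Context d (T : measurableType d) (R : realType).
Import HBNNSimple.
Local Open Scope ereal_scope.

(** Both sides are additive and continuous along increasing sequences, so it is
enough to compare them on the simple functions that approximate [f]. *)
Lemma ge0_integral_density (mu m : {measure set T -> \bar R}) (w : T -> R)
    (f : T -> \bar R) :
  measurable_fun setT w -> (forall x, 0 <= w x)%R ->
  (forall A, measurable A -> m A = \int[mu]_(x in A) (w x)%:E) ->
  measurable_fun setT f -> (forall x, 0 <= f x) ->
  \int[m]_x f x = \int[mu]_x (f x * (w x)%:E).
Proof.
move=> mw w0 mE mf f0.
pose f_ := nnsfun_approx measurableT mf.
have f_f x : EFin \o f_ ^~ x @ \oo --> f x by exact: cvg_nnsfun_approx.
transitivity (limn (fun n => \int[m]_x (f_ n x)%:E)).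
  rewrite -monotone_convergence//.
  - by apply: eq_integral => y _; apply/esym/cvg_lim => //; exact: f_f.
  - by move=> n; exact/measurable_EFinP.
  - by move=> n y _; rewrite lee_fin.
  - by move=> y _ a b ab; rewrite lee_fin; exact/lefP/nd_nnsfun_approx.
rewrite [X in limn X](_ : _ = (fun n => \int[mu]_x ((f_ n x)%:E * (w x)%:E))).
  rewrite -monotone_convergence//.
  - apply: eq_integral => x _; apply/cvg_lim => //.
    by apply: cvgeZr => //; exact: f_f.
  - by move=> n; apply: emeasurable_funM; exact/measurable_EFinP.
  - by move=> n x _; rewrite mule_ge0// lee_fin.
  - move=> x _ a b ab; rewrite lee_wpmul2r ?lee_fin//.
    exact/lefP/nd_nnsfun_approx.
apply/funext => n.
have mk (k : R) : measurable (f_ n @^-1` [set k]) by exact: measurable_funPTI.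
transitivity (\sum_(k \in range (f_ n))
    \int[mu]_x ((k * \1_(f_ n @^-1` [set k]) x)%:E * (w x)%:E)).
  under eq_integral do rewrite fimfunE -fsumEFin//.
  rewrite ge0_integral_fsum//; last 2 first.
  - by move=> y; exact/measurable_EFinP/measurable_funM.
  - by move=> y x _; rewrite nnfun_muleindic_ge0.
  apply: eq_fsbigr => r; rewrite inE => -[x _ fxr].
  have r0 : (0 <= r)%R by rewrite -fxr.
  rewrite integralZl_indic_nnsfun// integral_indic// setIT mE//.
  under [RHS]eq_integral do rewrite EFinM -muleA.
  rewrite ge0_integralZl//.
  - rewrite integral_mkcond; congr *%E; apply: eq_integral => y _.
    rewrite patchE indicE; case: ifPn => _; by rewrite ?mul1e ?mul0e.
  - by apply: emeasurable_funM; exact/measurable_EFinP.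
  - by move=> y _; rewrite mule_ge0// lee_fin.
rewrite -ge0_integral_fsum//.
- apply: eq_integral => x _; rewrite [in RHS]fimfunE -fsumEFin//.
  rewrite ge0_mule_fsuml// => r.
  exact: nnfun_muleindic_ge0.
- move=> r; apply: emeasurable_funM; apply/measurable_EFinP => //.
  exact/measurable_funM.
- move=> r x _; apply: mule_ge0; last by rewrite lee_fin.
  exact: nnfun_muleindic_ge0.
Qed.

End density.

(** * Gaussian integrals on the line *)

Section lebesgue_affine.
Context {R : realType}.
Local Notation mu := (@lebesgue_measure R).

Let maff (a b : R) : measurable_fun [set: measurableTypeR R]
  ((fun x => a * x + b) : measurableTypeR R -> measurableTypeR R).
Proof. by apply: measurable_funD => //; exact: measurable_funM. Qed.

(** Lebesgue measure is determined by its values on bounded intervals, and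
affine maps send intervals to intervals. *)
Lemma affine_preimage_lebesgue (a b : R) (A : set R) : a != 0 -> measurable A ->
  mu A = (`|a|%:E * mu ((fun x => a * x + b)%R @^-1` A))%E.
Proof.
move=> a0 mA.
have ann : (0 <= `|a|)%R by [].
pose m : {measure set (measurableTypeR R) -> \bar R} :=
  mscale (NngNum ann) (image_measure mu (maff a b)).
have lE B : image_measure mu (maff a b) B = mu ((fun x => a * x + b) @^-1` B) by [].
suff : mu A = m A by [].
apply: lebesgue_measure_unique => // _ [[u v]] _ <- /=.
rewrite /m /mscale /=.
have [a_gt0|a_lt0|/eqP] := ltrgtP 0 a; last by rewrite eq_sym (negbTE a0).
  rewrite lE (_ : _ @^-1` _ = `](u - b) / a, (v - b) / a]%classic); last first.
    apply/seteqP; split => x /=; rewrite !in_itv/= ltr_pdivrMr// ler_pdivlMr//;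
      by rewrite ltrBlDr lerBrDr (mulrC x).
  rewrite !lebesgue_measure_itv/= !lte_fin ltr_pM2r ?invr_gt0// ltrD2r.
  case: ifPn => uv; last by rewrite mule0.
  rewrite gtr0_norm// -!EFinB -EFinM; congr EFin; field.
  by rewrite gt_eqF.
rewrite lE (_ : _ @^-1` _ = `[(v - b) / a, (u - b) / a[%classic); last first.
  apply/seteqP; split => x /=; rewrite !in_itv/= ler_ndivrMr// ltr_ndivlMr//;
    by rewrite ltrBlDr lerBrDr (mulrC x) andbC.
rewrite !lebesgue_measure_itv/= !lte_fin ltr_nM2r ?invr_lt0// ltrD2r.
case: ifPn => uv; last by rewrite mule0.
rewrite ltr0_norm// -!EFinB -EFinM; congr EFin; field.
by rewrite lt_eqF.
Qed.

Lemma ge0_integral_affine (a b : R) (f : R -> \bar R) : a != 0 ->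
  measurable_fun [set: R] f -> (forall x, 0 <= f x)%E ->
  (\int[mu]_x f x = `|a|%:E * \int[mu]_x f (a * x + b)%R)%E.
Proof.
move=> a0 mf f0.
have ann : (0 <= `|a|)%R by [].
pose m : {measure set (measurableTypeR R) -> \bar R} :=
  mscale (NngNum ann) (image_measure mu (maff a b)).
transitivity (\int[m]_x f x)%E.
  apply: eq_measure_integral => /= A mA _.
  exact: affine_preimage_lebesgue.
rewrite ge0_integral_mscale//=; congr *%E.
by rewrite ge0_integral_image_measure.
Qed.

End lebesgue_affine.

Section gaussian_line.
Context {R : realType}.
Local Notation mu := (@lebesgue_measure R).

Local Notation phi := (normal_pdf (0 : R) 1).

Let measurable_idR : measurable_fun [set: measurableTypeR R]
  (fun x : measurableTypeR R => x : R).
Proof. by move=> _ A mA; rewrite setTI. Qed.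

(** The line as the domain of [lebesgue_measure] and the line as a real type have
the same measurable sets but different displays; this identity map moves the
normal law from the former to the latter. *)
Definition lebesgue_id (x : measurableTypeR R) : R := x.

HB.instance Definition _ := isMeasurableFun.Build _ _ _ _ lebesgue_id measurable_idR.

Definition std_gauss : probability R R := distribution (normal_prob (0 : R) 1) lebesgue_id.

Local Notation gauss := std_gauss.

Lemma std_normal_pdfE (x : R) :
  phi x = normal_peak 1 * expR (- (x ^+ 2 / 2)).
Proof.
rewrite normal_pdfE ?oner_neq0//; congr (_ * expR _).
by rewrite subr0 expr1n mulNr.
Qed.

Lemma ge0_integral_std_normal (f : R -> \bar R) :
  measurable_fun setT f -> (forall x, 0 <= f x)%E ->
  (\int[gauss]_x f x = \int[mu]_x (f x * (phi x)%:E))%E.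
Proof.
move=> mf f0; rewrite /std_gauss ge0_integral_distribution//.
apply: ge0_integral_density => //.
- exact: measurable_normal_pdf.
- by move=> x; exact: normal_pdf_ge0.
Qed.

Let mphi : measurable_fun setT (fun x => (phi x)%:E).
Proof. by apply/measurable_EFinP; exact: measurable_normal_pdf. Qed.

Let maffine (a b : R) : measurable_fun [set: R] (fun x : R => a * x + b).
Proof. by apply: measurable_funD => //; exact: measurable_funM. Qed.

(** The substitution x -> a x, with the change of density absorbed in the
integrand. Allowing a < 0 also yields the symmetry of the Gaussian law. *)
Lemma gaussian_scaling (a : R) (f : R -> \bar R) : a != 0 ->
  measurable_fun setT f -> (forall x, 0 <= f x)%E ->
  (\int[gauss]_x (f (a * x)%R *
      (`|a| * expR (- ((a ^+ 2 - 1) * (x ^+ 2 / 2))))%:E) =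
   \int[gauss]_x f x)%E.
Proof.
move=> a0 mf f0.
have mfa : measurable_fun setT (fun x => f (a * x)).
  by apply: measurableT_comp => //; exact: measurable_funM.
rewrite !ge0_integral_std_normal//; last 2 first.
- apply: emeasurable_funM => //; apply/measurable_EFinP.
  apply: measurable_funM => //; apply: measurableT_comp => //.
  apply: measurableT_comp => //; apply: measurable_funM => //.
  by apply: measurable_funM => //; exact: measurable_funX.
- by move=> x; rewrite mule_ge0// lee_fin mulr_ge0// expR_ge0.
rewrite [RHS](@ge0_integral_affine _ a 0)//; last 2 first.
- exact: emeasurable_funM.
- by move=> x; rewrite mule_ge0// lee_fin normal_pdf_ge0.
rewrite -ge0_integralZl//; last 2 first.
- apply: emeasurable_funM.
    exact: (measurableT_comp mf (maffine a 0)).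
  exact: (measurableT_comp mphi (maffine a 0)).
- by move=> x _; rewrite mule_ge0// lee_fin normal_pdf_ge0.
apply: eq_integral => x _; rewrite addr0 -muleA [RHS]muleCA; congr (_ * _)%E.
rewrite -!EFinM; congr EFin; rewrite !std_normal_pdfE.
rewrite -!mulrA; congr (_ * _); rewrite mulrCA; congr (_ * _).
by rewrite -expRD; congr expR; field.
Qed.

(** The sum a g + b h of independent standard normal g and h is distributed as
c g with c = sqrt(a ^ 2 + b ^ 2). Substituting u = a g + b h and completing the
square, phi((u - b h) / a) phi(h) = phi(u / c) phi(c h / a - b u / (a c)), and
the second factor integrates to |a| / c in h. *)
Lemma gaussian_stable (a b : R) (F : R -> \bar R) :
  measurable_fun setT F -> (forall x, 0 <= F x)%E ->
  (\int[gauss]_h \int[gauss]_g F (a * g + b * h)%R =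
   \int[gauss]_g F (Num.sqrt (a ^+ 2 + b ^+ 2) * g)%R)%E.
Proof.
move=> mF F0.
have mFa (c : R) : measurable_fun setT (fun x : R => F (c * x)%R).
  by apply: measurableT_comp => //; exact: measurable_funM.
have [a0|a0] := eqVneq a 0.
  transitivity (\int[gauss]_h F (b * h)%R)%E.
    apply: eq_integral => h _.
    transitivity (\int[gauss]_g (cst (F (b * h)%R) g))%E.
      by apply: eq_integral => g _; rewrite a0 mul0r add0r.
    exact: integral_prob_cst.
  rewrite a0 expr0n add0r sqrtr_sqr.
  have [b0|b0] := ger0P b; first by [].
  rewrite -(@gaussian_scaling (- 1))// ?oppr_eq0 ?oner_eq0//.
  apply: eq_integral => x _.
  by rewrite mulN1r mulrN mulNr normrN1 sqrrN expr1n subrr mul0r oppr0 expR0 mul1r mule1.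
set c := Num.sqrt _.
have c0 : 0 < c.
  by rewrite sqrtr_gt0 ltr_pwDl ?sqr_ge0// lt_neqAle sqr_ge0 eq_sym sqrf_eq0 a0.
have cc : c ^+ 2 = a ^+ 2 + b ^+ 2.
  by rewrite sqr_sqrtr// addr_ge0// sqr_ge0.
(* K u h is the joint density of (a g + b h, h) at (u, h) *)
pose K u h : R := `|a|^-1 * (phi (a^-1 * u + - (b * h) / a) * phi h).
have K0 u h : 0 <= K u h.
  by rewrite !mulr_ge0// ?invr_ge0//; exact: normal_pdf_ge0.
have mK : measurable_fun [set: R * R] (fun z => K z.1 z.2).
  apply: measurable_funM => //; apply: measurable_funM.
    apply: (measurableT_comp (measurable_normal_pdf _ _)) => //.
    apply: measurable_funD; first exact: measurable_funM.
    apply: measurable_funM => //; apply: measurableT_comp => //.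
    exact: measurable_funM.
  exact: (measurableT_comp (measurable_normal_pdf _ _)).
have mKl h : measurable_fun [set: R] (fun u => (K u h)%:E).
  by apply/measurable_EFinP; exact: (measurableT_comp mK (pair2_measurable h)).
have mKr u : measurable_fun [set: R] (fun h => (K u h)%:E).
  by apply/measurable_EFinP; exact: (measurableT_comp mK (pair1_measurable u)).
have mFab : measurable_fun [set: R * R] (fun z => F (a * z.2 + b * z.1)).
  apply: measurableT_comp => //.
  by apply: measurable_funD; exact: measurable_funM.
transitivity (\int[mu]_h \int[mu]_u (F u * (K u h)%:E))%E.
  rewrite ge0_integral_std_normal//; last 2 first.
  - exact: (@measurable_integral_param _ _ _ _ _ gauss (fun h g => F (a * g + b * h)%R)).
  - by move=> h; apply: integral_ge0.
  apply: eq_integral => h _.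
  rewrite ge0_integral_std_normal//; last first.
    by apply: measurableT_comp => //; exact: maffine.
  rewrite [RHS](@ge0_integral_affine _ a (b * h))//; last 2 first.
  - exact: emeasurable_funM.
  - by move=> x; rewrite mule_ge0// lee_fin.
  rewrite muleC -ge0_integralZl//; last 3 first.
  - apply: emeasurable_funM => //; exact: (measurableT_comp mF (maffine _ _)).
  - by move=> x _; rewrite mule_ge0// lee_fin normal_pdf_ge0.
  - by rewrite lee_fin normal_pdf_ge0.
  rewrite -ge0_integralZl//; last 2 first.
  - apply: emeasurable_funM; first exact: (measurableT_comp mF (maffine a (b * h))).
    exact: (measurableT_comp (mKl h) (maffine _ _)).
  - by move=> x _; rewrite mule_ge0// lee_fin.
  apply: eq_integral => g _.
  rewrite muleCA [RHS]muleCA; congr (_ * _)%E; rewrite -!EFinM; congr EFin.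
  rewrite /K (_ : _ + - (b * h) / a = g); last by field.
  rewrite mulrA mulfV ?normr_eq0// mul1r mulrC.
  done.
transitivity (\int[mu]_u \int[mu]_h (F u * (K u h)%:E))%E.
  apply: (fubini_tonelli (m1 := mu) (m2 := mu) (fun z => F z.2 * (K z.2 z.1)%:E)%E) => //.
  - apply: emeasurable_funM; first exact: measurableT_comp.
    apply/measurable_EFinP; exact: (measurableT_comp mK (@measurable_swap _ _ _ _)).
  - by move=> z; rewrite mule_ge0// lee_fin.
transitivity (\int[mu]_u (F u * (c^-1 * phi (c^-1 * u))%:E))%E.
  apply: eq_integral => u _.
  rewrite ge0_integralZl//; last 2 first.
  - exact: mKr.
  - by move=> h _; rewrite lee_fin.
  congr (_ * _)%E.
  have -> : (\int[mu]_h (K u h)%:E =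
    \int[mu]_h ((`|a|^-1 * phi (c^-1 * u))%:E * (phi (c / a * h + - (b * u / (a * c))))%:E))%E.
    apply: eq_integral => h _; rewrite -EFinM; congr EFin.
    rewrite /K -[RHS]mulrA; congr (_ * _); rewrite !std_normal_pdfE.
    rewrite mulrACA [RHS]mulrACA; congr (_ * _).
    rewrite -!expRD; congr expR.
    rewrite -!opprD -!mulrDl; congr (- (_ / _)).
    have -> : (c / a * h + - (b * u / (a * c))) ^+ 2 =
       (c^+2 / a ^+2 * h ^+2 - 2 * b * u * h / a ^+ 2 + b^+2 * u^+2/(a^+2 * c^+2)).
      by field; rewrite a0 gt_eqF.
    have -> : (c^-1 * u)^+2 = u^+2 / c^+2 by field; rewrite gt_eqF.
    rewrite cc; field.
    by rewrite a0/= -cc expf_neq0// gt_eqF.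
  rewrite ge0_integralZl//; last 3 first.
  - exact: (measurableT_comp mphi (maffine _ _)).
  - by move=> h _; rewrite lee_fin normal_pdf_ge0.
  - by rewrite lee_fin mulr_ge0 ?invr_ge0// normal_pdf_ge0.
  have ca0 : c / a != 0 by rewrite mulf_neq0 ?invr_eq0// gt_eqF.
  have phi0 x : (0 <= (phi x)%:E)%E by rewrite lee_fin normal_pdf_ge0.
  have := @ge0_integral_affine _ (c / a) (- (b * u / (a * c))) _ ca0 mphi phi0.
  rewrite integral_normal_pdf; set I := (\int[mu]_x _)%E => I1.
  have cna : c^-1 = `|a|^-1 * (`|c / a|^-1).
    by rewrite normrM normfV invfM invrK mulrCA mulVf ?normr_eq0// mulr1 gtr0_norm.
  have -> : (I = (`|c / a|^-1)%:E)%E.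
    by rewrite -[RHS]mule1 I1 muleA -EFinM mulVf ?mul1e// normr_eq0.
  by rewrite -EFinM mulrAC -cna.
rewrite ge0_integral_std_normal// (@ge0_integral_affine _ c 0)//.
- rewrite -ge0_integralZl//.
  + apply: eq_integral => g _; rewrite addr0 muleCA; congr (_ * _)%E.
    rewrite -EFinM; congr EFin; rewrite gtr0_norm// mulrA mulfV ?gt_eqF// mul1r.
    by rewrite mulrA mulVf ?gt_eqF// mul1r.
  + apply: emeasurable_funM; first exact: (measurableT_comp mF (maffine c 0)).
    apply/measurable_EFinP; apply: measurable_funM => //.
    apply: (measurableT_comp (measurable_normal_pdf _ _)).
    by apply: measurable_funM => //; exact: maffine.
  + by move=> x _; rewrite mule_ge0// lee_fin mulr_ge0 ?normal_pdf_ge0// invr_ge0 ltW.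
- by rewrite gt_eqF.
- apply: emeasurable_funM => //; apply/measurable_EFinP; apply: measurable_funM => //.
  by apply: (measurableT_comp (measurable_normal_pdf _ _)); exact: measurable_funM.
- by move=> x; rewrite mule_ge0// lee_fin mulr_ge0 ?normal_pdf_ge0// invr_ge0 ltW.
Qed.

End gaussian_line.

(** * The standard Gaussian law on tuples *)

Section gaussian_tuple.
Context {R : realType}.
Local Open Scope ereal_scope.

Definition tuple_cons n (z : R * n.-tuple R) : n.+1.-tuple R := [tuple of z.1 :: z.2].

Lemma measurable_tuple_cons n : measurable_fun setT (@tuple_cons n).
Proof. exact: measurable_cons. Qed.

HB.instance Definition _ n := isMeasurableFun.Build _ _ _ _ (@tuple_cons n)
  (@measurable_tuple_cons n).

(** Built one coordinate at a time, so that Tonelli's theorem for [product_measure1]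
turns every integral into an induction on the dimension. *)
Fixpoint gauss_tuple n : probability (n.-tuple R) R :=
  match n with
  | 0%N => dirac [tuple]
  | m.+1 => distribution (std_gauss \x gauss_tuple m) (@tuple_cons m)
  end.

Definition tuple_scale n (a : R) (v : n.-tuple R) : n.-tuple R :=
  map_tuple (fun t => a * t)%R v.

Definition sqnorm n (v : n.-tuple R) : R := \sum_(i < n) tnth v i ^+ 2.

Definition dot n (x y : n.-tuple R) : R := \sum_(i < n) tnth x i * tnth y i.

Lemma tnth_consS n x (v : n.-tuple R) i : tnth (tuple_cons (x, v)) (lift ord0 i) = tnth v i.
Proof. by rewrite tnthS. Qed.

Lemma tuple_scale_cons n a x (v : n.-tuple R) :
  tuple_scale a (tuple_cons (x, v)) = tuple_cons (a * x, tuple_scale a v)%R.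
Proof. exact: val_inj. Qed.

Lemma sqnorm_cons n x (v : n.-tuple R) :
  sqnorm (tuple_cons (x, v)) = (x ^+ 2 + sqnorm v)%R.
Proof.
rewrite /sqnorm big_ord_recl; congr (_ + _)%R.
by apply: eq_bigr => i _; rewrite tnth_consS.
Qed.

Lemma dot_cons n x y (v w : n.-tuple R) :
  dot (tuple_cons (x, v)) (tuple_cons (y, w)) = (x * y + dot v w)%R.
Proof.
rewrite /dot big_ord_recl; congr (_ + _)%R.
by apply: eq_bigr => i _; rewrite !tnth_consS.
Qed.

Lemma sqnorm_ge0 n (v : n.-tuple R) : (0 <= sqnorm v)%R.
Proof. by apply: sumr_ge0 => i _; exact: sqr_ge0. Qed.

Lemma measurable_sqnorm n : measurable_fun setT (@sqnorm n).
Proof.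
apply: measurable_sum => i; apply: measurable_funX; exact: measurable_tnth.
Qed.

Lemma measurable_dot n :
  measurable_fun setT (fun z : n.-tuple R * n.-tuple R => dot z.1 z.2).
Proof.
apply: measurable_sum => i; apply: measurable_funM.
  by apply: (measurableT_comp (measurable_tnth i)).
by apply: (measurableT_comp (measurable_tnth i)).
Qed.

Lemma measurable_tuple_scale n a : measurable_fun setT (@tuple_scale n a).
Proof.
apply/measurable_fun_tnthP => i.
rewrite (_ : _ \o _ = fun v => a * tnth v i)%R.
  by apply: measurable_funM => //; exact: measurable_tnth.
by apply/funext => v /=; rewrite tnth_map.
Qed.

Lemma ge0_integral_gauss_tuple0 (f : 0.-tuple R -> \bar R) :
  measurable_fun setT f ->
  \int[gauss_tuple 0]_v f v = f [tuple].
Proof. by move=> mf; rewrite /= integral_dirac// diracT mul1e. Qed.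

Lemma ge0_integral_gauss_tupleS n (f : n.+1.-tuple R -> \bar R) :
  measurable_fun setT f -> (forall v, 0 <= f v) ->
  \int[gauss_tuple n.+1]_v f v =
  \int[std_gauss]_x \int[gauss_tuple n]_v f (tuple_cons (x, v)).
Proof.
move=> mf f0; rewrite /= ge0_integral_distribution//.
rewrite -(tonelli_prod _ _ (f := fun x v => f (tuple_cons (x, v))))//.
rewrite (_ : (fun _ => _) = f \o @tuple_cons n); last by apply/funext => -[].
exact: measurableT_comp.
Qed.

Let mgw n a : measurable_fun [set: n.-tuple R] (fun v =>
  (`|a| ^+ n * expR (- ((a ^+ 2 - 1) * (sqnorm v / 2))))%:E)%R.
Proof.
apply/measurable_EFinP; apply: measurable_funM => //.
apply: measurableT_comp => //; apply: measurableT_comp => //.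
apply: measurable_funM => //; apply: measurable_funM => //.
exact: measurable_sqnorm.
Qed.

Lemma gauss_tuple_scaling n (a : R) (f : n.-tuple R -> \bar R) : (a != 0)%R ->
  measurable_fun setT f -> (forall v, 0 <= f v) ->
  \int[gauss_tuple n]_v (f (tuple_scale a v) *
    (`|a| ^+ n * expR (- ((a ^+ 2 - 1) * (sqnorm v / 2))))%R%:E) =
  \int[gauss_tuple n]_v f v.
Proof.
move=> a0; elim: n => [|n IH] in f *.
  move=> mf f0; rewrite !ge0_integral_gauss_tuple0//.
    rewrite /sqnorm big_ord0 mul0r mulr0 oppr0 expR0 expr0 mulr1 mule1.
    by rewrite tuple0.
  apply: emeasurable_funM; last exact: mgw.
  exact: (measurableT_comp mf (@measurable_tuple_scale _ _)).
move=> mf f0.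
have mfc : measurable_fun setT (fun z : R * n.-tuple R => f (tuple_cons (z.1, z.2))).
  rewrite (_ : (fun _ => _) = f \o @tuple_cons n); last by apply/funext => -[].
  exact: measurableT_comp.
rewrite !ge0_integral_gauss_tupleS//; last 2 first.
- apply: emeasurable_funM; last exact: mgw.
  exact: (measurableT_comp mf (@measurable_tuple_scale _ _)).
- by move=> v; rewrite mule_ge0// lee_fin mulr_ge0// expR_ge0.
rewrite -[RHS](@gaussian_scaling _ a)//; last 2 first.
- by apply: (@measurable_integral_param _ _ _ _ _ (gauss_tuple n)
    (fun x v => f (tuple_cons (x, v)))) => // x y; exact: f0.
- by move=> x; apply: integral_ge0.
apply: eq_integral => x _.
have mfx y : measurable_fun setT (fun v => f (tuple_cons (y, v))).
  exact: (measurableT_comp mfc (pair1_measurable y)).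
rewrite -(IH (fun v => f (tuple_cons (a * x, v)%R)))//.
rewrite -ge0_integralZr//; last 2 first.
- apply: emeasurable_funM; last exact: mgw.
  exact: (measurableT_comp (mfx _) (@measurable_tuple_scale _ _)).
- by move=> v _; rewrite mule_ge0// lee_fin mulr_ge0// expR_ge0.
apply: eq_integral => v _.
rewrite -muleA -EFinM tuple_scale_cons sqnorm_cons (exprS _ n); congr (_ * _%:E).
by rewrite (mulrDl (x ^+ 2)%R) (mulrDr (a ^+ 2 - 1)%R) opprD expRD; ring.
Qed.

(** Linear forms of a Gaussian vector are Gaussian: add the coordinates one at a
time with [gaussian_stable]. *)
Lemma gauss_tuple_dot n (y : n.-tuple R) (F : R -> \bar R) :
  measurable_fun setT F -> (forall t, 0 <= F t) ->
  \int[gauss_tuple n]_v F (dot v y) =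
  \int[std_gauss]_g F (Num.sqrt (sqnorm y) * g)%R.
Proof.
elim: n => [|n IH] in y F *.
  move=> mF F0; rewrite ge0_integral_gauss_tuple0//.
    transitivity (\int[std_gauss]_g (cst (F 0%R) g)).
      by rewrite integral_prob_cst /dot big_ord0.
    by apply: eq_integral => g _; rewrite /sqnorm big_ord0 sqrtr0 mul0r.
  apply: (measurableT_comp mF).
  exact: (measurableT_comp (@measurable_dot 0) (pair2_measurable y)).
move=> mF F0.
rewrite ge0_integral_gauss_tupleS//; last first.
  apply: (measurableT_comp mF).
  exact: (measurableT_comp (@measurable_dot _) (pair2_measurable y)).
have [y0 [w ->]] : exists y0 w, y = tuple_cons (y0, w).
  by exists (thead y), [tuple of behead y]; rewrite [LHS]tuple_eta.
rewrite sqnorm_cons addrC -[X in Num.sqrt (X + _)]sqr_sqrtr ?sqnorm_ge0//.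
rewrite -gaussian_stable//; apply: eq_integral => h _.
transitivity (\int[gauss_tuple n]_v F (h * y0 + dot v w)%R).
  by apply: eq_integral => v _; rewrite dot_cons.
rewrite (IH w (fun t => F (h * y0 + t)%R))//.
  by apply: eq_integral => g _; rewrite addrC (mulrC h).
by apply: (measurableT_comp mF); exact: measurable_funD.
Qed.

End gaussian_tuple.

Section gaussian_vector_law.
Context {R : realType}.
Local Open Scope ereal_scope.

Definition box n (B : 'I_n -> set R) : set (n.-tuple R) :=
  [set v | forall i, B i (tnth v i)].

Definition boxes n : set (set (n.-tuple R)) :=
  [set A | exists2 B : 'I_n -> set R, (forall i, measurable (B i)) & A = box B].

Lemma measurable_box n (B : 'I_n -> set R) :
  (forall i, measurable (B i)) -> measurable (box B).
Proof.
move=> mB; have -> : box B = \big[setI/setT]_(i < n) ((@tnth n R)^~ i @^-1` B i).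
  rewrite -bigcap_seq; apply/seteqP; split => v /= Bv i; first by move=> _; exact: Bv.
  by apply: Bv; rewrite /= mem_index_enum.
apply: bigsetI_measurable => i _; rewrite -[X in measurable X]setTI.
by apply: measurable_tnth.
Qed.

Lemma boxes_setI_closed n : setI_closed (@boxes n).
Proof.
move=> _ _ [B mB ->] [C mC ->]; exists (fun i => B i `&` C i).
  by move=> i; exact: measurableI.
apply/seteqP; split => v /=.
  by move=> [Bv Cv] i.
by move=> BCv; split => i; have [] := BCv i.
Qed.

(** Boxes are stable under intersection and generate the sigma-algebra of tuples,
so a probability on tuples is determined by its values on them. *)
Lemma measurable_tuple_boxes n : @measurable _ (n.-tuple R) = <<s @boxes n >>.
Proof.
apply/seteqP; split; last first.
  apply: smallest_sub; first exact: sigma_algebra_measurable.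
  by move=> _ [B mB ->]; exact: measurable_box.
apply: smallest_sub; first exact: smallest_sigma_algebra.
rewrite -bigcup_seq; apply: bigcup_sub => i _ _ [A mA <-]; rewrite setTI.
apply: sub_sigma_algebra; exists (fun j => if j == i then A else setT).
  by move=> j; case: ifP.
apply/seteqP; split => v /=; first by move=> Av j; case: ifPn => // /eqP ->.
by move=> /(_ i); rewrite eqxx.
Qed.

Lemma gauss_tuple_box n (B : 'I_n -> set R) : (forall i, measurable (B i)) ->
  gauss_tuple n (box B) = \prod_(i < n) std_gauss (B i).
Proof.
elim: n => [|n IH] in B * => mB.
  by rewrite big_ord0 /= diracE mem_set// => -[].
rewrite big_ord_recl -IH// -product_measure1E//; last exact: measurable_box.
rewrite /= /distribution /pushforward; congr (_ _).
apply/seteqP; split=> -[x v] /=.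
  move=> h; split; first exact: (h ord0).
  by move=> i; have := h (lift ord0 i); rewrite tnth_consS.
move=> [hx hv] i; case: (unliftP ord0 i) => [j|] ->; last exact: hx.
by rewrite tnth_consS; exact: hv.
Qed.

Context d (T : measurableType d) (P : probability T R).

(** Mutual independence of the coordinates says exactly that the law of the vector
gives boxes the product of the masses of their sides. *)
Lemma standard_normal_law n (N : {RV P >-> n.-tuple R}) :
  standard_normal_vector N ->
  forall A, measurable A -> distribution P N A = gauss_tuple n A.
Proof.
move=> [ind gaussN].
apply: (@measure_unique _ _ _ (@boxes n) (fun=> setT)).
- exact: measurable_tuple_boxes.
- exact: boxes_setI_closed.
- move=> _; exists (fun=> setT) => //.
  by apply/seteqP; split.
- by rewrite bigcup_const.
- move=> _ [B mB ->]; rewrite [RHS](gauss_tuple_box mB).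
  have := ind [set: 'I_n]%SET B mB.
  rewrite (eq_bigl xpredT); last by move=> i; rewrite inE.
  under eq_bigr => i _ do rewrite -[P _]/(pushforward P _ (B i)) gaussN//.
  move=> <-; congr (P _); apply/seteqP; split => w /= h i.
    by move=> _; exact: h.
  by apply: h; rewrite /= inE.
- by move=> _; rewrite (_ : _ setT = 1) ?ltry//; exact: probability_setT.
Qed.

Lemma ge0_integral_independent_gauss n (N1 N2 : {RV P >-> n.-tuple R})
    (f : n.-tuple R -> n.-tuple R -> \bar R) :
  standard_normal_vector N1 -> standard_normal_vector N2 ->
  independent2 N1 N2 ->
  measurable_fun setT (fun z : n.-tuple R * n.-tuple R => f z.1 z.2) ->
  (forall x y, 0 <= f x y) ->
  \int[P]_w f (N1 w) (N2 w) =
  \int[gauss_tuple n]_x \int[gauss_tuple n]_y f x y.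
Proof.
move=> g1 g2 ind mf f0.
have mN : measurable_fun setT (fun w => (N1 w, N2 w)) by exact: measurable_fun_pair.
rewrite -tonelli_prod//.
transitivity (\int[image_measure P mN]_z f z.1 z.2).
  by rewrite ge0_integral_image_measure.
apply: eq_measure_integral => A mA _; apply/esym.
apply: product_measure_unique => // B C mB mC.
transitivity (distribution P N1 B * distribution P N2 C); first exact: ind.
by congr (_ * _); exact: standard_normal_law.
Qed.

End gaussian_vector_law.

(** * Uniqueness of Laplace transforms *)

Section laplace.
Context {R : realType}.

(** Bernoulli's inequality. *)
Lemma bernoulli_ge (q : R) m : 0 <= q <= 1 -> 1 - m%:R * q <= (1 - q) ^+ m.
Proof.
move=> /andP[q0 q1]; elim: m => [|m IH]; first by rewrite mul0r subr0 expr0.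
rewrite exprS (le_trans _ (ler_wpM2l _ IH)) ?subr_ge0//.
rewrite (_ : (1 - q) * _ = 1 - m.+1%:R * q + m%:R * q * q); last by rewrite -natr1; ring.
by rewrite lerDl !mulr_ge0.
Qed.

Lemma expR_ge1 (x : R) : (1 <= expR x) = (0 <= x).
Proof. by rewrite -[1]expR0 ler_expR. Qed.

Lemma cvg_invn : n%:R^-1 @[n --> \oo] --> (0 : R).
Proof.
rewrite gtr0_cvgV0; first exact: cvgr_idn.
by exists 1%N => // n /= n1; rewrite ltr0n.
Qed.

(** Chosen so that the polynomials (1 - X ^ n) ^ (threshold_exponent s n) in
X = exp (- y) converge to the indicator of y > s at every y >= 0. The exponent is
of the order of n exp (s n); the factor n makes the limit at y = s equal to 0,
where exp (s n) alone would give exp (- 1). *)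
Definition threshold_exponent (s : R) n : nat := n * (Num.trunc (expR (s * n%:R))).+1.

(** By Bernoulli's inequality 1 - (1 - q) ^ m <= m q, which here is at most
2 n exp (- (y - s) n). *)
Lemma threshold_cvg1 (s y : R) : 0 <= s -> s < y ->
  (1 - expR (- y) ^+ n) ^+ threshold_exponent s n @[n --> \oo] --> (1 : R).
Proof.
move=> s0 sy; have d0 : 0 < y - s by rewrite subr_gt0.
have e01 n : 0 <= expR (- y) ^+ n <= 1.
  rewrite exprn_ge0 ?expR_ge0//= exprn_ile1 ?expR_ge0// expR_le1 oppr_le0.
  by rewrite (le_trans s0)// ltW.
have bound n : (threshold_exponent s n)%:R * expR (- y) ^+ n <= (4 / (y - s) ^+ 2) * n%:R^-1.
  case: n => [|n]; first by rewrite /threshold_exponent mul0n mul0r invr0 mulr0.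
  rewrite -expRM_natr.
  set N := n.+1%:R.
  have e1 : 1 <= expR (s * N) by rewrite expR_ge1 mulr_ge0.
  have t2 : (Num.trunc (expR (s * N))).+1%:R <= 2 * expR (s * N).
    have /andP[h _] := truncn_itv (expR_ge0 (s * N)).
    by rewrite -natr1; lra.
  have N0 : 0 < N by rewrite ltr0n.
  have e2 : ((y - s) * N) ^+ 2 / 2 <= expR ((y - s) * N).
    have := @expR_ge1Dxn _ ((y - s) * N) 1 (mulr_ge0 (ltW d0) (ltW N0)).
    by rewrite (_ : 2`!%:R = 2 :> R)//; lra.
  have E : expR (s * N) * expR (- y * N) = (expR ((y - s) * N))^-1.
    by rewrite -expRD -expRN; congr expR; ring.
  rewrite natrM -/N.
  apply: (@le_trans _ _ (N * (2 * (expR (s * N) * expR (- y * N))))).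
    rewrite -mulrA ler_wpM2l ?(ltW N0)// [leRHS]mulrA.
    by rewrite ler_wpM2r ?expR_ge0.
  rewrite E.
  have p0 : 0 < ((y - s) * N) ^+ 2 / 2 by rewrite divr_gt0// exprn_gt0// mulr_gt0.
  have : (expR ((y - s) * N))^-1 <= (((y - s) * N) ^+ 2 / 2)^-1.
    by rewrite lef_pV2// posrE expR_gt0.
  move=> h; apply: (@le_trans _ _ (N * (2 * (((y - s) * N) ^+ 2 / 2)^-1))).
    by rewrite ler_wpM2l ?(ltW N0)// ler_wpM2l.
  rewrite le_eqVlt; apply/orP; left; apply/eqP; field.
  by rewrite !gt_eqF.
apply: (@squeeze_cvgr _ _ _ _ (fun n => 1 - (4 / (y - s) ^+ 2) * n%:R^-1) (fun=> 1)).
- apply: nearW => n; apply/andP; split.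
    by apply: le_trans (bernoulli_ge _ (e01 n)); rewrite lerB.
  have /andP[h1 h2] := e01 n.
  by rewrite exprn_ile1 ?subr_ge0// gerBl.
- rewrite -[X in _ --> X]subr0 -[X in _ --> _ - X](mulr0 (4 / (y - s) ^+ 2)).
  apply: cvgB; first exact: cvg_cst.
  by apply: cvgMr; exact: cvg_invn.
- exact: cvg_cst.
Qed.

(** (1 - q) ^ m <= exp (- m q), and here m q >= n. *)
Lemma threshold_cvg0 (s y : R) : 0 <= y -> y <= s ->
  (1 - expR (- y) ^+ n) ^+ threshold_exponent s n @[n --> \oo] --> (0 : R).
Proof.
move=> y0 ys.
have e01 n : 0 <= expR (- y) ^+ n <= 1.
  by rewrite exprn_ge0 ?expR_ge0//= exprn_ile1 ?expR_ge0// expR_le1 oppr_le0.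
apply: (@squeeze_cvgr _ _ _ _ (fun=> 0) (fun n => n%:R^-1)).
- near=> n; apply/andP; split.
    by have /andP[h1 h2] := e01 n; rewrite exprn_ge0// subr_ge0.
  have n0 : (0 < n)%N by near: n; exists 1%N.
  apply: (@le_trans _ _ (expR (- (expR (- y) ^+ n)) ^+ threshold_exponent s n)).
    apply: lerXn2r; rewrite ?nnegrE ?expR_ge0//.
      by have /andP[h1 h2] := e01 n; rewrite subr_ge0.
    exact: expR_ge1Dx.
  rewrite -(expRM_natr (threshold_exponent s n)) mulNr [expR (- (_ * _))]expRN lef_pV2 ?posrE ?expR_gt0 ?ltr0n//.
  apply: le_trans (expR_ge1Dx _).
  rewrite natrM mulrCA -[leLHS]mulr1.
  suff : 1 <= expR (- y) ^+ n * (Num.trunc (expR (s * n%:R))).+1%:R.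
    move=> h; apply: (@le_trans _ _ (n%:R * (expR (- y) ^+ n * (Num.trunc (expR (s * n%:R))).+1%:R))).
      by rewrite ler_wpM2l.
    by rewrite lerDr.
  rewrite -expRM_natr.
  apply: (@le_trans _ _ (expR (- y * n%:R) * expR (s * n%:R))).
    by rewrite -expRD expR_ge1 -mulrDl mulr_ge0// addrC subr_ge0.
  by rewrite ler_wpM2l ?expR_ge0// ltW// truncnS_gt.
- exact: cvg_cst.
- exact: cvg_invn.
Unshelve. all: by end_near.
Qed.

End laplace.

Section laplace_uniqueness.
Context d (T : measurableType d) (R : realType).
Context (Y : T -> R).
Hypothesis mY : measurable_fun setT Y.
Hypothesis Y0 : forall x, 0 <= Y x.
Local Open Scope ereal_scope.

Let q x := expR (- Y x).

Let q01 x : (0 <= q x <= 1)%R.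
Proof. by rewrite expR_ge0 expR_le1 oppr_le0 Y0. Qed.

Let mq : measurable_fun setT q.
Proof. by apply: measurableT_comp => //; exact: measurableT_comp. Qed.

Let integrable_qX (m : {measure set T -> \bar R}) k : m setT < +oo ->
  m.-integrable setT (fun x => (q x ^+ k)%:E).
Proof.
move=> moo; apply: measurable_bounded_integrable => //.
  exact: measurable_funX.
exists 1%R; split => // M M1 x _ /=.
have /andP[? ?] := q01 x.
by rewrite ger0_norm ?exprn_ge0// (le_trans _ (ltW M1))// exprn_ile1.
Qed.

Let integral_horner (m : {measure set T -> \bar R}) (p : {poly R}) : m setT < +oo ->
  \int[m]_x (p.[q x])%:E = \sum_(i < size p) (p`_i)%:E * \int[m]_x (q x ^+ i)%:E.
Proof.
move=> moo.
transitivity (\int[m]_x (\sum_(i < size p) (p`_i)%:E * (q x ^+ i)%:E)).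
  by apply: eq_integral => x _; rewrite horner_coef -sumEFin.
rewrite integral_sum//; last by move=> i; apply: integrableZl => //; exact: integrable_qX.
by apply: eq_bigr => i _; rewrite integralZl//; exact: integrable_qX.
Qed.

Context (m1 m2 : {measure set T -> \bar R}).
Hypothesis m1oo : m1 setT < +oo.
Hypothesis m2oo : m2 setT < +oo.
Hypothesis m12 : forall k, \int[m1]_x (expR (- Y x) ^+ k)%:E =
                           \int[m2]_x (expR (- Y x) ^+ k)%:E.

Let measurable_tail s : measurable [set x | (s < Y x)%R].
Proof.
rewrite (_ : [set _ | _] = Y @^-1` `]s, +oo[%classic); last first.
  by apply/seteqP; split => x /=; rewrite in_itv/= andbT.
by rewrite -[X in measurable X]setTI; exact: mY.
Qed.

Let tail_cvg (m : {measure set T -> \bar R}) s : m setT < +oo -> (0 <= s)%R ->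
  \int[m]_x (((1 - 'X^n) ^+ threshold_exponent s n).[q x])%:E @[n --> \oo]
    --> m [set x | (s < Y x)%R].
Proof.
move=> moo s0.
have <- : \int[m]_x (\1_[set x | (s < Y x)%R] x)%:E = m [set x | (s < Y x)%R].
  by rewrite integral_indic// setIT.
apply: (@dominated_cvg _ _ _ m _ measurableT _ _ (cst 1)) => //.
- move=> n; apply/measurable_EFinP.
  rewrite (_ : (fun _ => _) = (fun x => (1 - q x ^+ n) ^+ threshold_exponent s n)%R).
    by apply: measurable_funX; apply: measurable_funB => //; exact: measurable_funX.
  by apply/funext => x; rewrite !hornerE.
- move=> x _; apply: cvg_EFin; first exact: nearW.
  rewrite (_ : _ \o _ = (fun n => (1 - q x ^+ n) ^+ threshold_exponent s n)%R); last first.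
    by apply/funext => n /=; rewrite !hornerE.
  rewrite indicE; have [sy|ys] := ltP s (Y x).
    by rewrite mem_set//; exact: threshold_cvg1.
  by rewrite memNset/= ?ltNge ?ys//; apply: threshold_cvg0.
- apply: measurable_bounded_integrable => //.
  by exists 1%R; split => // M M1 x _ /=; rewrite normr1 ltW.
- move=> n x _; rewrite !hornerE /= lee_fin.
  have /andP[h1 h2] : (0 <= q x ^+ n <= 1)%R.
    by have /andP[? ?] := q01 x; rewrite exprn_ge0//= exprn_ile1.
  by rewrite ger0_norm ?exprn_ge0 ?subr_ge0// exprn_ile1 ?subr_ge0// gerBl.
Qed.

(** The integrals of exp (- k Y) for integers k give those of all polynomials in
exp (- Y). The polynomials of [threshold_exponent] converge boundedly to the
indicator of Y > s, so the two measures give the same mass to every event Y > s. *)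
Lemma laplace_unique B : measurable B -> m1 (Y @^-1` B) = m2 (Y @^-1` B).
Proof.
have tails s : m1 [set x | (s < Y x)%R] = m2 [set x | (s < Y x)%R].
  have [s0|s0] := leP 0%R s.
    have h1 := tail_cvg m1oo s0; have h2 := tail_cvg m2oo s0.
    suff e : (fun n => \int[m1]_x (((1 - 'X^n) ^+ threshold_exponent s n).[q x])%:E) =
             (fun n => \int[m2]_x (((1 - 'X^n) ^+ threshold_exponent s n).[q x])%:E).
      by rewrite e in h1; exact: (cvg_unique _ h1 h2).
    apply/funext => n; rewrite !integral_horner//.
    by apply: eq_bigr => i _; rewrite m12.
  have -> : [set x | (s < Y x)%R] = setT.
    by apply/seteqP; split => // x _ /=; rewrite (lt_le_trans s0).
  have := m12 0; under eq_integral do rewrite expr0.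
  under [in X in _ = X -> _]eq_integral do rewrite expr0.
  by rewrite !integral_cst// !mul1e.
move=> mB; rewrite -(image_measureE m1 mY) -(image_measureE m2 mY).
apply: (measure_unique (@RGenOInfty.G R) (fun k => `](- k%:R)%R, +oo[%classic)) => //.
- exact: RGenOInfty.measurableE.
- move=> _ _ [s ->] [t ->]; exists (Num.max s t).
  by apply/seteqP; split => x /=; rewrite !in_itv/= !andbT gt_max => /andP.
- by move=> k; eexists.
- apply/seteqP; split => // x _; exists (Num.trunc `|x|).+1 => //=.
  rewrite in_itv/= andbT ltrNl; apply: le_lt_trans (truncnS_gt _).
  by rewrite -normrN ler_norm.
- move=> _ [s ->].
  have E : Y @^-1` `]s, +oo[%classic = [set x | (s < Y x)%R].
    by apply/seteqP; split => x /=; rewrite in_itv/= andbT.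
  by rewrite -[LHS]/(m1 (Y @^-1` _)) -[RHS]/(m2 (Y @^-1` _)) E.
- move=> k; rewrite image_measureE; apply: le_lt_trans m1oo; apply: le_measure => //; rewrite inE//.
  by rewrite -[X in measurable X]setTI; exact: mY.
Qed.

End laplace_uniqueness.

(** * Independence of radius and direction *)

Section polar_independence.
Context {R : realType} (n : nat).
Local Open Scope ereal_scope.

Lemma measurable_enorm : measurable_fun setT (@enorm R n).
Proof.
apply: measurableT_comp; last exact: measurable_sqnorm.
by apply: continuous_measurable_fun; exact: sqrt_continuous.
Qed.

Context d2 (T2 : measurableType d2) (V : n.-tuple R -> T2).
Hypothesis mV : measurable_fun setT V.
Hypothesis scaleV : forall a x, (0 < a)%R -> V (tuple_scale a x) = V x.

Let Y (x : n.-tuple R) : R := (sqnorm x / 2)%R.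

Let mY : measurable_fun setT Y.
Proof. by apply: measurable_funM => //; exact: measurable_sqnorm. Qed.

Let Y0 x : (0 <= Y x)%R.
Proof. by rewrite divr_ge0// sqnorm_ge0. Qed.

Let mexpY k : measurable_fun setT (fun x => (expR (- Y x) ^+ k)%:E).
Proof.
apply/measurable_EFinP; apply: measurable_funX.
by apply: measurableT_comp => //; exact: measurableT_comp.
Qed.

Let laplace_cone (C : set T2) k : measurable C ->
  (Num.sqrt (1 + k%:R) ^+ n)%:E *
  \int[gauss_tuple n]_x ((\1_(V @^-1` C) x)%:E * (expR (- Y x) ^+ k)%:E) =
  gauss_tuple n (V @^-1` C).
Proof.
move=> mC.
have mVC : measurable (V @^-1` C) by rewrite -[X in measurable X]setTI; exact: mV.
have k1 : (0 < 1 + k%:R :> R)%R by rewrite ltr_pwDl.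
set a := Num.sqrt _.
have a0 : (0 < a)%R by rewrite sqrtr_gt0.
have aa : (a ^+ 2 = 1 + k%:R)%R by rewrite sqr_sqrtr// ltW.
have <- : \int[gauss_tuple n]_x (\1_(V @^-1` C) x)%:E = gauss_tuple n (V @^-1` C).
  by rewrite integral_indic// setIT.
rewrite -[RHS](@gauss_tuple_scaling _ _ a)//; last 2 first.
- by rewrite gt_eqF.
- exact/measurable_EFinP.
rewrite -ge0_integralZl//; last 2 first.
- by apply: emeasurable_funM => //; exact/measurable_EFinP.
- by rewrite lee_fin exprn_ge0// ltW.
apply: eq_integral => x _.
have -> : \1_(V @^-1` C) (tuple_scale a x) = \1_(V @^-1` C) x :> R.
  rewrite !indicE; congr (_%:R); congr nat_of_bool.
  by apply/idP/idP; rewrite !inE/= scaleV.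
rewrite muleCA; congr (_ * _); rewrite -EFinM; congr EFin.
rewrite gtr0_norm// -expRM_natl; congr (_ * expR _)%R.
by rewrite aa -/(Y x); ring.
Qed.

(** For an integer k, rescaling by sqrt (1 + k) evaluates the integral of
exp (- k |x| ^ 2 / 2) over the event V in C, on which V is unaffected, as
(1 + k) ^ (- n / 2) P(V in C). Hence |x| ^ 2 / 2 has the same Laplace transform
under the Gaussian law restricted to V in C and under P(V in C) times that law. *)
Lemma polar_independence (A : set R) (C : set T2) : measurable A -> measurable C ->
  gauss_tuple n (@enorm R n @^-1` A `&` V @^-1` C) =
  gauss_tuple n (@enorm R n @^-1` A) * gauss_tuple n (V @^-1` C).
Proof.
move=> mA mC.
have mVC : measurable (V @^-1` C) by rewrite -[X in measurable X]setTI; exact: mV.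
pose m1 : {measure set (n.-tuple R) -> \bar R} := mrestr (gauss_tuple n) mVC.
have c0 : (0 <= fine (gauss_tuple n (V @^-1` C)))%R by rewrite fine_ge0.
pose m2 : {measure set (n.-tuple R) -> \bar R} := mscale (NngNum c0) (gauss_tuple n).
have -> : @enorm R n @^-1` A = Y @^-1` ((fun t => Num.sqrt (2 * t)) @^-1` A).
  by apply/seteqP; split => x /=; rewrite /enorm /Y /sqnorm mulrC divfK.
have mB : measurable ((fun t : R => Num.sqrt (2 * t)) @^-1` A).
  rewrite -[X in measurable X]setTI.
  have : measurable_fun setT (fun t : R => Num.sqrt (2 * t)).
    apply: measurableT_comp; last exact: measurable_funM.
    by apply: continuous_measurable_fun; exact: sqrt_continuous.
  exact.
have cE : (fine (gauss_tuple n (V @^-1` C)))%:E = gauss_tuple n (V @^-1` C).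
  by rewrite fineK// fin_num_measure.
rewrite muleC -cE.
suff key : m1 (Y @^-1` ((fun t => Num.sqrt (2 * t)) @^-1` A)) =
           m2 (Y @^-1` ((fun t => Num.sqrt (2 * t)) @^-1` A)) by exact: key.
have m1oo : m1 setT < +oo.
  exact: le_lt_trans (probability_le1 (gauss_tuple n) (measurableI _ _ measurableT mVC)) (ltry _).
have m2oo : m2 setT < +oo.
  rewrite [X in X < _](_ : _ = (fine (gauss_tuple n (V @^-1` C)))%:E) ?ltry//.
  by rewrite -[RHS]mule1; congr (_ * _); exact: probability_setT.
apply: (laplace_unique mY Y0 m1oo m2oo _ mB) => k.
  rewrite (@ge0_integral_density _ _ _ (gauss_tuple n) m1 (\1_(V @^-1` C)))//; last first.
  + by move=> B mB'; rewrite integral_indic// setIC.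
  rewrite ge0_integral_mscale//.
  have := laplace_cone k mC; have := laplace_cone k measurableT.
  set u := (Num.sqrt _ ^+ n)%R; set I1 := integral _ _ _; set IC := integral _ _ _.
  rewrite preimage_setT probability_setT => h1 hC.
  have u0 : (u != 0)%R by rewrite expf_neq0// gt_eqF// sqrtr_gt0 ltr_pwDl.
  have -> : \int[gauss_tuple n]_x (expR (- Y x) ^+ k)%:E = I1.
    by apply: eq_integral => x _; rewrite preimage_setT indicT mul1e.
  have uK (z : \bar R) : z = (u^-1)%:E * (u%:E * z).
    by rewrite muleA -EFinM mulVf// mul1e.
  rewrite (uK I1) h1 mule1 /= cE -hC muleC -uK.
  by apply: eq_integral => x _; rewrite muleC.
Qed.

Lemma integral_polar (F : R -> T2 -> \bar R) :
  measurable_fun setT (fun z : R * T2 => F z.1 z.2) -> (forall r s, 0 <= F r s) ->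
  \int[gauss_tuple n]_x F (enorm x) (V x) =
  \int[gauss_tuple n]_x \int[gauss_tuple n]_y F (enorm x) (V y).
Proof.
move=> mF F0.
have mN := measurable_enorm.
have mNV : measurable_fun setT (fun x : n.-tuple R => (enorm x, V x)).
  exact: measurable_fun_pair.
have mFr r : measurable_fun setT (F r).
  exact: (measurableT_comp mF (pair1_measurable r)).
transitivity (\int[image_prob (gauss_tuple n) mNV]_z F z.1 z.2).
  by rewrite ge0_integral_image_prob.
transitivity (\int[image_prob (gauss_tuple n) mN \x image_prob (gauss_tuple n) mV]_z F z.1 z.2).
  apply: eq_measure_integral => A mA _; apply/esym.
  apply: product_measure_unique => // B C mB mC.
  exact: polar_independence.
rewrite tonelli_prod// ge0_integral_image_prob//.
- by apply: eq_integral => x _; rewrite ge0_integral_image_prob.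
- exact: measurable_integral_param.
- by move=> y; exact: integral_ge0.
Qed.

End polar_independence.

(** * Moments from a scaling identity, and Gamma at half-integers *)

Section moment_by_scaling.
Context {R : realType}.

(** The scales a = 1 / b > 1 tend to 1 and h = a ^ 2 - 1 tends to 0. *)
Let b (k : nat) : R := (1 + k.+1%:R^-1)^-1.

Let b01 k : 0 < b k < 1.
Proof.
rewrite /b invr_gt0 addr_gt0//= invf_lt1 ?addr_gt0// ltrDl.
by rewrite invr_gt0 ltr0n.
Qed.

Let b_cvg : b n @[n --> \oo] --> (1 : R).
Proof.
rewrite -[X in _ --> X]invr1; apply: cvgV; first exact: oner_neq0.
rewrite -[X in _ --> X]addr0; apply: cvgD; first exact: cvg_cst.
exact: cvg_harmonic.
Qed.

Let h k : R := (b k)^-1 ^+ 2 - 1.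

Let h_gt0 k : 0 < h k.
Proof.
have /andP[b0 b1] := b01 k.
by rewrite subr_gt0 exprn_egt1// invf_gt1.
Qed.

Let h_cvg : h n @[n --> \oo] --> (0 : R).
Proof.
rewrite /h -[X in _ --> X](subrr 1); apply: cvgB; last exact: cvg_cst.
rewrite -[X in _ --> X](mulr1 1); apply: cvgM;
  rewrite -[X in _ --> X]invr1; (apply: cvgV; [exact: oner_neq0 | exact: b_cvg]).
Qed.

Let c (N k : nat) : R := (1 - b k ^+ N) / h k.

Let c_cvg N : c N n @[n --> \oo] --> (N%:R / 2 : R).
Proof.
have -> : c N = fun k => (b k * b k * (\poly_(i < N) 1).[b k]) * (1 + b k)^-1.
  apply/funext => k; have /andP[b0 b1] := b01 k.
  have hE : h k = (1 - b k) * (1 + b k) / b k ^+ 2 by rewrite /h; field; rewrite gt_eqF.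
  rewrite /c hE horner_poly.
  under eq_bigr do rewrite mul1r.
  have -> : 1 - b k ^+ N = (1 - b k) * \sum_(i < N) b k ^+ i.
    by rewrite -[LHS]opprB subrX1 -mulNr opprB.
  field.
  by rewrite subr_eq0 !gt_eqF// addr_gt0.
have -> : N%:R / 2 = (1 * 1 * (\poly_(i < N) 1).[1]) * (1 + 1)^-1 :> R.
  rewrite horner_poly; under eq_bigr do rewrite expr1n mul1r.
  by rewrite sumr_const card_ord !mul1r.
apply: cvgM; last first.
  apply: cvgV; first by rewrite gt_eqF.
  by apply: cvgD; [exact: cvg_cst|exact: b_cvg].
apply: cvgM; first by apply: cvgM; exact: b_cvg.
apply: (@continuous_cvg _ _ _ _ _ _ (fun x : R => (\poly_(i < N) 1).[x]) 1 _ b_cvg).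
exact: continuous_horner.
Qed.

Context d (T : measurableType d) (mu : {measure set T -> \bar R}).
Context (w f : T -> R) (N : nat).
Hypotheses (mw : measurable_fun setT w) (mf : measurable_fun setT f).
Hypotheses (w0 : forall x, 0 <= w x) (f0 : forall x, 0 <= f x).
Local Open Scope ereal_scope.
Hypothesis woo : \int[mu]_x (w x)%:E < +oo.
Hypothesis scale : forall a : R, (1 < a)%R ->
  (a ^+ N)%:E * \int[mu]_x (w x * expR (- ((a ^+ 2 - 1) * f x)))%:E =
  \int[mu]_x (w x)%:E.

Let g k x : R := (w x * ((1 - expR (- (h k * f x))) / h k))%R.

Let exp_le1 k x : (expR (- (h k * f x)) <= 1)%R.
Proof. by rewrite expR_le1 oppr_le0; exact: mulr_ge0 (ltW (h_gt0 k)) (f0 x). Qed.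

Let g0 k x : (0 <= g k x)%R.
Proof.
apply: mulr_ge0 => //; apply: divr_ge0; last exact: ltW (h_gt0 k).
by rewrite subr_ge0; exact: exp_le1.
Qed.

Let g_le k x : (g k x <= w x * f x)%R.
Proof.
apply: ler_wpM2l => //; rewrite ler_pdivrMr; last exact: h_gt0.
by have := expR_ge1Dx (- (h k * f x)); lra.
Qed.

Let g_ge k x : (w x * f x / (1 + h k * f x) <= g k x)%R.
Proof.
have hf0 : (0 <= h k * f x)%R by exact: mulr_ge0 (ltW (h_gt0 k)) (f0 x).
have p : (0 < 1 + h k * f x)%R by rewrite ltr_pwDl.
rewrite /g -mulrA; apply: ler_wpM2l => //.
rewrite ler_pdivlMr; last exact: h_gt0.
rewrite mulrAC ler_pdivrMr//.
have : (expR (- (h k * f x)) * (1 + h k * f x) <= 1)%R.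
  rewrite -ler_pdivlMr// mul1r expRN lef_pV2 ?posrE ?expR_gt0//.
  exact: expR_ge1Dx.
by set e := expR _; lra.
Qed.

Let mexp k : measurable_fun setT (fun x => expR (- (h k * f x))).
Proof.
by apply: measurableT_comp => //; apply: measurableT_comp => //; exact: measurable_funM.
Qed.

Let mg k : measurable_fun setT (g k).
Proof.
apply: measurable_funM => //; apply: measurable_funM => //.
exact: measurable_funB.
Qed.

Let g_cvg x : g k x @[k --> \oo] --> (w x * f x)%R.
Proof.
apply: (@squeeze_cvgr _ _ _ _ (fun k => w x * f x / (1 + h k * f x))%R
  (fun=> w x * f x)%R).
- by apply: nearW => k; rewrite g_ge g_le.
- rewrite -[X in _ --> X]mulr1; apply: cvgM; first exact: cvg_cst.
  rewrite -[X in _ --> X]invr1; apply: cvgV; first exact: oner_neq0.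
  rewrite -[X in _ --> X]addr0 -[X in (_ + X)%R](mul0r (f x)).
  apply: cvgD; first exact: cvg_cst.
  by apply: cvgM; [exact: h_cvg|exact: cvg_cst].
- exact: cvg_cst.
Qed.

Let W := fine (\int[mu]_x (w x)%:E).

Let WE : \int[mu]_x (w x)%:E = W%:E.
Proof. by rewrite fineK// ge0_fin_numE// integral_ge0// => x _; rewrite lee_fin. Qed.

Let integral_g k : \int[mu]_x (g k x)%:E = (c N k * W)%:E.
Proof.
have /andP[b0 b1] := b01 k.
have ia : (1 < (b k)^-1)%R by rewrite invf_gt1.
have bN : (b k ^+ N != 0)%R by rewrite expf_neq0// gt_eqF.
have e1 : \int[mu]_x (w x * expR (- (h k * f x)))%:E = (b k ^+ N * W)%:E.
  rewrite EFinM -WE -(scale ia) muleA -EFinM -exprMn mulfV ?gt_eqF// expr1n mul1e.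
  by [].
have e2 : \int[mu]_x (w x)%:E =
    (h k)%:E * \int[mu]_x (g k x)%:E + \int[mu]_x (w x * expR (- (h k * f x)))%:E.
  rewrite -ge0_integralZl//; last 3 first.
  - exact/measurable_EFinP.
  - by move=> x _; rewrite lee_fin.
  - by rewrite lee_fin ltW ?h_gt0.
  rewrite -ge0_integralD//.
  - apply: eq_integral => x _; rewrite -EFinM -EFinD; congr EFin.
    by rewrite /g; field; rewrite gt_eqF.
  - by move=> x _; rewrite -EFinM lee_fin mulr_ge0// ltW ?h_gt0.
  - by apply: measurable_funeM; exact/measurable_EFinP.
  - by move=> x _; rewrite lee_fin mulr_ge0// expR_ge0.
  - by apply/measurable_EFinP; exact: measurable_funM.
have gE : \int[mu]_x (g k x)%:E = (h k)^-1%:E * ((h k)%:E * \int[mu]_x (g k x)%:E).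
  by rewrite muleA -EFinM mulVf ?mul1e// gt_eqF.
have hgE : (h k)%:E * \int[mu]_x (g k x)%:E = (W - b k ^+ N * W)%:E.
  by rewrite [RHS]EFinB -WE e2 e1 addeK.
by rewrite gE hgE -EFinM; congr EFin; rewrite /c; ring.
Qed.

(** The scaling hypothesis reads: the integral of w exp (- (a ^ 2 - 1) f) is
a ^ (- N) times that of w. Differentiating at a = 1 gives the claim. Along a
sequence h = a ^ 2 - 1 -> 0 the difference quotients
w (1 - exp (- h f)) / h are at most w f and converge to it, with integrals
(1 - a ^ (- N)) / h times that of w; Fatou's lemma gives one inequality and the
pointwise bound the other. Only integer powers of a occur, for Gaussian norms
as well as for Gamma at N / 2. *)
Lemma moment_by_scaling : \int[mu]_x (w x * f x)%:E = (N%:R / 2 * W)%:E.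
Proof.
have cW : (c N k * W)%:E @[k --> \oo] --> (N%:R / 2 * W)%:E.
  apply: cvg_EFin; first exact: nearW.
  by apply: cvgM; [exact: c_cvg|exact: cvg_cst].
apply/eqP; rewrite eq_le; apply/andP; split.
  have -> : \int[mu]_x (w x * f x)%:E = \int[mu]_x limn_einf (fun k => (g k x)%:E).
    apply: eq_integral => x _; apply/esym.
    apply: (cvg_limn_einf_sup _).1.
    by apply: cvg_EFin; [exact: nearW|exact: g_cvg].
  apply: le_trans (fatou mu measurableT _ _) _.
  - by move=> k; exact/measurable_EFinP.
  - by move=> k x _; rewrite lee_fin.
  rewrite (_ : (fun _ => _) = (fun k => (c N k * W)%:E)); last first.
    by apply/funext => k; exact: integral_g.
  by rewrite (cvg_limn_einf_sup cW).1.
rewrite -(cvg_lim _ cW)//; apply: lime_le; first by apply/cvg_ex; eexists; exact: cW.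
apply: nearW => k; rewrite -integral_g; apply: ge0_le_integral => //.
- by move=> x _; rewrite lee_fin.
- exact/measurable_EFinP.
- by apply/measurable_EFinP; exact: measurable_funM.
- by move=> x _; rewrite lee_fin.
Qed.

End moment_by_scaling.

Section gamma_half_integers.
Context {R : realType}.
Local Notation mu := (@lebesgue_measure R).

Definition gamma_integrand (N : nat) (t : R) : R :=
  if 0 < t then t `^ (N%:R / 2 - 1) * expR (- t) else 0.

Lemma gamma_integrand_ge0 N t : 0 <= gamma_integrand N t.
Proof.
by rewrite /gamma_integrand; case: ifP => // _; rewrite mulr_ge0 ?powR_ge0 ?expR_ge0.
Qed.

Lemma measurable_gamma_integrand N : measurable_fun setT (gamma_integrand N).
Proof.
apply: measurable_fun_ifT => //; first exact: measurable_fun_ltr.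
apply: measurable_funM; first exact: measurable_powR.
by apply: measurableT_comp => //; exact: measurableT_comp.
Qed.

Lemma Gamma_half N :
  (Gamma (N%:R / 2 : R)) = fine (\int[mu]_t (gamma_integrand N t)%:E).
Proof.
rewrite /Gamma /Rintegral; congr fine; rewrite integral_mkcond.
apply: eq_integral => t _; rewrite patchE /gamma_integrand.
have [t0|t0] := ltP 0 t; first by rewrite mem_set//= in_itv/= t0.
by rewrite memNset//= in_itv/= ltNge t0.
Qed.

Lemma gamma_integrand_scaling N (a : R) : 1 < a ->
  ((a ^+ N)%:E * \int[mu]_t (gamma_integrand N t * expR (- ((a ^+ 2 - 1) * `|t|)))%:E =
   \int[mu]_t (gamma_integrand N t)%:E)%E.
Proof.
move=> a1; have a0 : 0 < a by rewrite (lt_trans _ a1).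
have aa0 : 0 < a ^+ 2 by rewrite exprn_gt0.
have mw := measurable_gamma_integrand N.
rewrite [RHS](@ge0_integral_affine _ (a ^+ 2) 0)//; last 3 first.
- by rewrite gt_eqF.
- exact/measurable_EFinP.
- by move=> t; rewrite lee_fin gamma_integrand_ge0.
rewrite -!ge0_integralZl//.
- apply: eq_integral => t _; rewrite -!EFinM; congr EFin; rewrite addr0.
  rewrite /gamma_integrand pmulr_rgt0//; case: ifPn => t0; last by rewrite mul0r !mulr0.
  rewrite (gtr0_norm aa0) (gtr0_norm t0) powRM ?ltW//.
  have e : a ^+ 2 * (a ^+ 2) `^ (N%:R / 2 - 1) = a ^+ N.
    rewrite -{1}(powRr1 (ltW aa0)) -powRD; last by rewrite (gt_eqF aa0) implybT.
    rewrite -(powR_mulrn 2 (ltW a0)) -powRrM -(powR_mulrn N (ltW a0)).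
    by congr powR; field.
  rewrite -e -!mulrA; congr (_ * (_ * (_ * _))); rewrite -expRD; congr (_ * expR _); ring.
- apply/measurable_EFinP; apply: (measurableT_comp mw).
  by apply: measurable_funD => //; exact: measurable_funM.
- by move=> t _; rewrite lee_fin gamma_integrand_ge0.
- apply/measurable_EFinP; apply: measurable_funM => //.
  apply: measurableT_comp => //; apply: measurableT_comp => //.
  by apply: measurable_funM => //; exact: normr_measurable.
- by move=> t _; rewrite lee_fin mulr_ge0 ?gamma_integrand_ge0 ?expR_ge0.
- by rewrite lee_fin exprn_ge0// ltW.
Qed.

(** Gamma (x + 1) = x Gamma x at x = N / 2, by differentiating the effect of
t -> a ^ 2 t. *)
Lemma gamma_integrand_step N :
  (\int[mu]_t (gamma_integrand N t)%:E < +oo)%E ->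
  (\int[mu]_t (gamma_integrand N.+2 t)%:E = (N%:R / 2 * Gamma (N%:R / 2 : R))%:E)%E.
Proof.
move=> oo; rewrite Gamma_half.
rewrite -(@moment_by_scaling _ _ _ mu (gamma_integrand N) (fun t : R => `|t|) N)//.
- apply: eq_integral => t _; congr EFin; rewrite /gamma_integrand.
  case: ifPn => t0; last by rewrite mul0r.
  rewrite (gtr0_norm t0) mulrAC; congr (_ * _).
  rewrite -{3}(powRr1 (ltW t0)) -powRD; last by rewrite (gt_eqF t0) implybT.
  by congr powR; rewrite -addn2 natrD; field.
- exact: measurable_gamma_integrand.
- exact: normr_measurable.
- exact: gamma_integrand_ge0.
- exact: gamma_integrand_scaling.
Qed.

Let measurable_inv1Dsqr : measurable_fun [set: R] (fun u : R => ((1 + u ^+ 2)^-1)%:E).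
Proof.
apply/measurable_EFinP; apply: measurable_inv_ge0.
  by apply: measurable_funD => //; exact: measurable_funX.
by move=> u; rewrite addr_ge0// sqr_ge0.
Qed.

Lemma integral_inv1Dsqr_lty : (\int[mu]_u ((1 + u ^+ 2)^-1)%:E < +oo)%E.
Proof.
have m := measurable_inv1Dsqr.
have p (u : R) : (0 <= ((1 + u ^+ 2)^-1)%:E)%E.
  by rewrite lee_fin invr_ge0 addr_ge0// sqr_ge0.
rewrite (_ : [set: R] = `]-oo, 0[%classic `|` `[0, +oo[%classic); last first.
  by apply/seteqP; split => // u _; rewrite /= !in_itv/= andbT; case: ltP; [left|right].
rewrite ge0_integral_setU//=; last 2 first.
- exact: measurable_funTS.
- apply/disj_setPS => u [] /=; rewrite !in_itv/= andbT => u0.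
  by rewrite leNgt u0.
rewrite integral_itv_bndo_bndc; last exact: measurable_funTS.
have -> : (\int[mu]_(u in `]-oo, 0%R]) ((1 + u ^+ 2)^-1)%:E =
    \int[mu]_(u in `[0%R, +oo[) ((1 + u ^+ 2)^-1)%:E)%E.
  rewrite (ge0_integration_by_substitution0 m p).
  by apply: eq_integral => u _; rewrite sqrrN.
have := integral0y_oneDsqr R; rewrite /oneDsqr => ->.
by rewrite -EFinD ltry.
Qed.

(** For t > 0, t ^ (- 1/2) is the integral over u of phi (sqrt t u), where phi is
the standard normal density. By Tonelli's theorem the integral of
t ^ (- 1/2) exp (- t) becomes a multiple of that of 1 / (1 + u ^ 2 / 2). *)
Lemma gamma_integrand1_lty : (\int[mu]_t (gamma_integrand 1 t)%:E < +oo)%E.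
Proof.
pose phi := normal_pdf (0 : R) 1.
have phi0 u : 0 <= phi u by exact: normal_pdf_ge0.
have mphi : measurable_fun setT phi by exact: measurable_normal_pdf.
pose K t u := gamma_integrand 2 t * phi (Num.sqrt t * u).
have K0 t u : 0 <= K t u by rewrite mulr_ge0 ?gamma_integrand_ge0.
have mK : measurable_fun [set: R * R] (fun z => (K z.1 z.2)%:E).
  apply/measurable_EFinP; apply: measurable_funM.
    exact: (measurableT_comp (measurable_gamma_integrand 2)).
  apply: (measurableT_comp mphi); apply: measurable_funM => //.
  apply: measurableT_comp => //.
  by apply: continuous_measurable_fun; exact: sqrt_continuous.
have -> : (\int[mu]_t (gamma_integrand 1 t)%:E = \int[mu]_t \int[mu]_u (K t u)%:E)%E.
  apply: eq_integral => t _; rewrite /K.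
  under [RHS]eq_integral do rewrite EFinM.
  rewrite ge0_integralZl//.
  - rewrite /gamma_integrand; case: ifPn => t0; last by rewrite mul0e.
    have st0 : 0 < Num.sqrt t by rewrite sqrtr_gt0.
    have mphiE : measurable_fun setT (fun u => (phi u)%:E) by exact/measurable_EFinP.
    have phiE0 u : (0 <= (phi u)%:E)%E by rewrite lee_fin.
    have := @ge0_integral_affine _ (Num.sqrt t) 0 _ (lt0r_neq0 st0) mphiE phiE0.
    rewrite integral_normal_pdf.
    under [X in _ = (_ * X)%E -> _]eq_integral do rewrite addr0.
    set I := (\int[mu]_u _)%E => I1.
    have -> : (I = (Num.sqrt t)^-1%:E)%E.
      rewrite -[RHS]mule1 I1 muleA -EFinM gtr0_norm// mulVf ?mul1e//.
      exact: lt0r_neq0.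
    rewrite -EFinM divff// subrr powRr0 mul1r mulrC; congr (_ * _)%:E.
    rewrite -powR12_sqrt ?(ltW t0)// -(powR_inv1 (powR_ge0 t 2^-1)) -powRrM.
    by congr powR; field.
  - apply/measurable_EFinP; apply: (measurableT_comp mphi).
    exact: measurable_funM.
  - by move=> u _; rewrite lee_fin.
  - by rewrite lee_fin gamma_integrand_ge0.
rewrite (@tonelli_swap _ _ _ _ _ mu mu (fun t u => (K t u)%:E))//.
have int_exp (c : R) : 1 <= c ->
    (\int[mu]_t (gamma_integrand 2 t * expR (- ((c - 1) * t)))%:E <= (c^-1)%:E)%E.
  move=> c1; have c0 : 0 < c by rewrite (lt_le_trans _ c1).
  have -> : ((c^-1)%:E = (c^-1)%:E * \int[mu]_t (exponential_pdf c t)%:E)%E.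
    by rewrite integral_exponential_pdf// mule1.
  have me : measurable_fun [set: R] (fun t => (exponential_pdf c t)%:E).
    by apply/measurable_EFinP; exact: measurable_exponential_pdf.
  have e0 t : (0 <= (exponential_pdf c t)%:E)%E.
    by rewrite lee_fin exponential_pdf_ge0// ltW.
  rewrite -ge0_integralZl//; last by rewrite lee_fin invr_ge0 ltW.
  apply: ge0_le_integral => //.
  - by move=> t _; rewrite lee_fin mulr_ge0 ?gamma_integrand_ge0 ?expR_ge0.
  - apply/measurable_EFinP; apply: measurable_funM.
      exact: measurable_gamma_integrand.
    by apply: measurableT_comp => //; apply: measurableT_comp => //; exact: measurable_funM.
  - exact: measurable_funeM.
  - move=> t _; rewrite -EFinM lee_fin /gamma_integrand; case: ifPn => t0.
      rewrite divff// subrr powRr0 mul1r -expRD exponential_pdfE ?(ltW t0)//=.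
      by rewrite mulrA mulVf ?gt_eqF// mul1r ler_expR; lra.
    rewrite mul0r mulr_ge0// ?invr_ge0 ?(ltW c0)//.
    by rewrite -lee_fin.
apply: (@le_lt_trans _ _ (\int[mu]_u ((normal_peak 1 * 2)%:E * ((1 + u ^+ 2)^-1)%:E))%E).
  apply: ge0_le_integral => //.
  - by move=> u _; apply: integral_ge0 => t _; rewrite lee_fin.
  - apply: (@measurable_integral_param _ _ _ _ _ mu (fun u t => (K t u)%:E)).
      exact: (measurableT_comp mK (@measurable_swap _ _ _ _)).
    by move=> u t; rewrite lee_fin.
  - exact: measurable_funeM.
  move=> u _.
  have -> : (\int[mu]_t (K t u)%:E = (normal_peak 1)%:E *
      \int[mu]_t (gamma_integrand 2 t * expR (- ((1 + u ^+ 2 / 2 - 1) * t)))%:E)%E.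
    rewrite -ge0_integralZl//.
    - apply: eq_integral => t _; rewrite -EFinM; congr EFin.
      rewrite /K mulrCA; rewrite /gamma_integrand; case: ifPn => t0; last by rewrite !mul0r.
      congr (_ * _); rewrite /phi std_normal_pdfE; congr (_ * expR _).
      by rewrite exprMn sqr_sqrtr ?(ltW t0)//; field.
    - apply/measurable_EFinP; apply: measurable_funM.
        exact: measurable_gamma_integrand.
      by apply: measurableT_comp => //; apply: measurableT_comp => //; exact: measurable_funM.
    - by move=> t _; rewrite lee_fin mulr_ge0 ?gamma_integrand_ge0 ?expR_ge0.
    - by rewrite lee_fin normal_peak_ge0.
  have c1 : 1 <= 1 + u ^+ 2 / 2 by rewrite lerDl divr_ge0// sqr_ge0.
  apply: (@le_trans _ _ ((normal_peak 1)%:E * ((1 + u ^+ 2 / 2)^-1)%:E)%E).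
    apply: lee_pmul => //; first by rewrite lee_fin normal_peak_ge0.
      by apply: integral_ge0 => t _; rewrite lee_fin mulr_ge0 ?gamma_integrand_ge0 ?expR_ge0.
    exact: int_exp.
  rewrite -!EFinM lee_fin -[leRHS]mulrA ler_wpM2l ?normal_peak_ge0//.
  have u1 : 0 < 1 + u ^+ 2 by rewrite ltr_pwDl// sqr_ge0.
  rewrite -ler_pdivrMr ?invr_gt0// invrK ler_pdivrMl ?(lt_le_trans _ c1)//.
  by have := sqr_ge0 u; lra.
rewrite ge0_integralZl//; last 2 first.
- by move=> u _; rewrite lee_fin invr_ge0 addr_ge0// sqr_ge0.
- by rewrite lee_fin mulr_ge0// normal_peak_ge0.
by rewrite lte_mul_pinfty// ?lee_fin ?mulr_ge0 ?normal_peak_ge0// integral_inv1Dsqr_lty.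
Qed.

Lemma gamma_integrand2_lty : (\int[mu]_t (gamma_integrand 2 t)%:E < +oo)%E.
Proof.
apply: (@le_lt_trans _ _ 1%E); last by rewrite ltry.
rewrite -(integral_exponential_pdf (@ltr01 R)); apply: ge0_le_integral => //.
- by move=> t _; rewrite lee_fin gamma_integrand_ge0.
- by apply/measurable_EFinP; exact: measurable_gamma_integrand.
- by apply/measurable_EFinP; exact: measurable_exponential_pdf.
move=> t _; rewrite lee_fin /gamma_integrand; case: ifPn => t0; last exact: exponential_pdf_ge0.
by rewrite exponential_pdfE ?(ltW t0)// divff// subrr powRr0 mulN1r.
Qed.

Lemma gamma_integrand_lty N : (0 < N)%N ->
  (\int[mu]_t (gamma_integrand N t)%:E < +oo)%E.
Proof.
suff h M : (\int[mu]_t (gamma_integrand M.+1 t)%:E < +oo)%E /\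
    (\int[mu]_t (gamma_integrand M.+2 t)%:E < +oo)%E.
  by case: N => // N _; have [] := h N.
elim: M => [|M [IH1 IH2]]; first by split; [exact: gamma_integrand1_lty|exact: gamma_integrand2_lty].
split; first exact: IH2.
by rewrite gamma_integrand_step; [exact: ltry|exact: IH1].
Qed.

(** The integrand is bounded below on [1/2, 1]. *)
Lemma Gamma_half_gt0 N : (0 < N)%N -> 0 < Gamma (N%:R / 2 : R).
Proof.
move=> N0; rewrite Gamma_half fine_gt0// gamma_integrand_lty// andbT.
pose c := Num.min 1 (2^-1 `^ (N%:R / 2 - 1) : R) * expR (- 1).
have c0 : 0 < c by rewrite mulr_gt0 ?expR_gt0// lt_min ltr01 powR_gt0.
have h : (0%R < \int[mu]_(t in `[2^-1%R, 1%R]%classic) (cst c%:E t))%E.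
  rewrite integral_cst//= lebesgue_measure_itv/= lte_fin.
  by rewrite ifT -?EFinB -?EFinM ?lte_fin ?mulr_gt0//; lra.
apply: (lt_le_trans h).
rewrite integral_mkcond; apply: ge0_le_integral => //.
- by move=> t _; rewrite patchE; case: ifP => // _; rewrite lee_fin ltW.
- by apply/(measurable_restrictT _ _).1; [exact: measurable_itv|exact: measurable_cst].
- by apply/measurable_EFinP; exact: measurable_gamma_integrand.
move=> t _; rewrite patchE; case: ifPn => [|_]; last by rewrite lee_fin gamma_integrand_ge0.
rewrite inE/= in_itv/= => /andP[t2 t1].
have t0 : 0 < t by rewrite (lt_le_trans _ t2).
rewrite lee_fin /gamma_integrand t0.
apply: ler_pM; rewrite ?ler_expR ?lerN2 ?expR_ge0 ?le_min ?ler01 ?powR_ge0//.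
have [e0|e0] := leP 0 (N%:R / 2 - 1 : R).
  by rewrite ge_min; apply/orP; right; rewrite ge0_ler_powR// nnegrE ltW.
rewrite ge_min; apply/orP; left.
have : t `^ (- (N%:R / 2 - 1)) <= 1 `^ (- (N%:R / 2 - 1)).
  by apply: ge0_ler_powR; rewrite ?nnegrE ?oppr_ge0 ?(ltW e0) ?(ltW t0).
by rewrite powR1 powRN invf_le1 ?powR_gt0.
Qed.

Lemma Gamma_halfS N : (0 < N)%N ->
  Gamma (N%:R / 2 + 1 : R) = N%:R / 2 * Gamma (N%:R / 2 : R).
Proof.
move=> N0; rewrite (_ : _ + 1 = N.+2%:R / 2); last by rewrite -addn2 natrD; field.
by rewrite Gamma_half gamma_integrand_step//; exact: gamma_integrand_lty.
Qed.

Lemma pochhammer_half N l : (0 < N)%N ->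
  pochhammer (N%:R / 2 : R) l = \prod_(i < l) (N%:R / 2 + i%:R).
Proof.
move=> N0; elim: l => [|l IH].
  by rewrite big_ord0 /pochhammer addr0 divff// gt_eqF// Gamma_half_gt0.
rewrite big_ord_recr/= -IH /pochhammer -[l.+1%:R]natr1 addrA.
have e : N%:R / 2 + l%:R = (N + l.*2)%:R / 2 :> R.
  by rewrite natrD -muln2 natrM; field.
by rewrite e Gamma_halfS ?addn_gt0 ?N0//; ring.
Qed.

End gamma_half_integers.

(** * The cosine of two independent Gaussian vectors *)

Section rising.
Context {R : realFieldType}.
(** The Pochhammer symbol (c)_l. *)
Definition rising (c : R) (l : nat) : R := \prod_(i < l) (c + i%:R).

Lemma rising0 c : rising c 0 = 1. Proof. by rewrite /rising big_ord0. Qed.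

Lemma risingS c l : rising c l.+1 = rising c l * (c + l%:R).
Proof. by rewrite /rising big_ord_recr. Qed.

Lemma rising_gt0 c l : 0 < c -> 0 < rising c l.
Proof. by move=> c0; apply: prodr_gt0 => i _; rewrite ltr_pwDl. Qed.
End rising.

Section bipolar.
Local Open Scope ereal_scope.
Context d (X : measurableType d) (R : realType) (P : probability X R).
Context (N : X -> R) (C : X -> X -> R).
Hypothesis mN : measurable_fun setT N.
Hypothesis mC : measurable_fun setT (fun z : X * X => C z.1 z.2).
Hypothesis polar_l : forall y (F : R -> R -> \bar R),
  measurable_fun setT (fun z : R * R => F z.1 z.2) -> (forall r u, 0 <= F r u) ->
  \int[P]_x F (N x) (C x y) = \int[P]_x \int[P]_x' F (N x) (C x' y).
Hypothesis polar_r : forall x (F : R -> R -> \bar R),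
  measurable_fun setT (fun z : R * R => F z.1 z.2) -> (forall r u, 0 <= F r u) ->
  \int[P]_y F (N y) (C x y) = \int[P]_y \int[P]_y' F (N y) (C x y').

Let swapP (f : X -> X -> \bar R) :
  measurable_fun setT (fun z : X * X => f z.1 z.2) -> (forall x y, 0 <= f x y) ->
  \int[P]_x \int[P]_y f x y = \int[P]_y \int[P]_x f x y.
Proof. exact: tonelli_swap. Qed.

(** The independence of (N x, N y) and C x y follows from that of N x and C x y for
each y and of N y and C x y for each x, by exchanging integrals. *)
Lemma integral_bipolar_abstract (F : R * R -> R -> \bar R) :
  measurable_fun setT (fun z : (R * R) * R => F z.1 z.2) ->
  (forall r u, 0 <= F r u) ->
  \int[P]_x \int[P]_y F (N x, N y) (C x y) =
  \int[P]_x \int[P]_y \int[P]_x' \int[P]_y' F (N x, N y) (C x' y').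
Proof.
move=> mF F0.
have mFc d' (T : measurableType d') (f g h : T -> R) : measurable_fun setT f ->
    measurable_fun setT g -> measurable_fun setT h ->
    measurable_fun setT (fun t => F (f t, g t) (h t)).
  move=> mf mg mh.
  apply: (measurableT_comp (f := fun z : (R * R) * R => F z.1 z.2)
    (g := fun t => ((f t, g t), h t))) => //.
  by apply: measurable_fun_pair => //; exact: measurable_fun_pair.
have mCc d' (T : measurableType d') (f g : T -> X) : measurable_fun setT f ->
    measurable_fun setT g -> measurable_fun setT (fun t => C (f t) (g t)).
  move=> mf mg; apply: (measurableT_comp mC (g := fun t => (f t, g t))).
  exact: measurable_fun_pair.
have mNc d' (T : measurableType d') (f : T -> X) : measurable_fun setT f ->
    measurable_fun setT (fun t => N (f t)) by move=> mf; exact: measurableT_comp.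
have mp d' (T : measurableType d') (g : T -> X -> \bar R) :
    measurable_fun setT (fun z : T * X => g z.1 z.2) -> (forall x y, 0 <= g x y) ->
    measurable_fun setT (fun t => \int[P]_x g t x).
  by move=> mg g0; exact: measurable_integral_param.
transitivity (\int[P]_x \int[P]_y \int[P]_y' F (N x, N y) (C x y')).
  apply: eq_integral => x _; apply: (polar_r x (F := fun r u => F (N x, r) u)) => //.
  exact: mFc.
transitivity (\int[P]_y \int[P]_x \int[P]_y' F (N x, N y) (C x y')).
  apply: (@swapP (fun x y => \int[P]_y' F (N x, N y) (C x y'))).
    apply: (mp _ _ (fun z y' => F (N z.1, N z.2) (C z.1 y'))) => //.
    apply: mFc; [apply: mNc|apply: mNc|apply: mCc => //]; exact: measurableT_comp.
  by move=> x y; exact: integral_ge0.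
transitivity (\int[P]_y \int[P]_x \int[P]_x' \int[P]_y' F (N x, N y) (C x' y')).
  apply: eq_integral => y _.
  transitivity (\int[P]_y' \int[P]_x F (N x, N y) (C x y')).
    apply: (@swapP (fun x y' => F (N x, N y) (C x y'))) => //.
    by apply: mFc => //; exact: mNc.
  transitivity (\int[P]_y' \int[P]_x \int[P]_x' F (N x, N y) (C x' y')).
    apply: eq_integral => y' _.
    apply: (polar_l y' (F := fun r u => F (r, N y) u)) => //.
    exact: mFc.
  transitivity (\int[P]_x \int[P]_y' \int[P]_x' F (N x, N y) (C x' y')).
    apply: (@swapP (fun y' x => \int[P]_x' F (N x, N y) (C x' y'))).
      apply: (mp _ _ (fun z x' => F (N z.2, N y) (C x' z.1))) => //.
      apply: mFc => //; [apply: mNc|apply: mCc => //]; exact: measurableT_comp.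
    by move=> x y'; exact: integral_ge0.
  apply: eq_integral => x _.
  apply: (@swapP (fun y' x' => F (N x, N y) (C x' y'))) => //.
  apply: mFc => //; exact: mCc.
apply/esym; apply: (@swapP (fun x y => \int[P]_x' \int[P]_y' F (N x, N y) (C x' y'))).
  apply: (mp _ _ (fun z x' => \int[P]_y' F (N z.1, N z.2) (C x' y'))).
    apply: (mp _ _ (fun w y' => F (N w.1.1, N w.1.2) (C w.2 y'))) => //.
    apply: mFc.
    - by apply: mNc; do 2 apply: measurableT_comp => //.
    - by apply: mNc; do 2 apply: measurableT_comp => //.
    - by apply: mCc => //; exact: measurableT_comp.
  by move=> z x'; exact: integral_ge0.
by move=> x y; apply: integral_ge0 => x' _; exact: integral_ge0.
Qed.

End bipolar.

Section gaussian_cosine.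
Context {R : realType} (n : nat).
Local Open Scope ereal_scope.
Local Notation G := (@gauss_tuple R n).

Lemma sqnorm_scale (a : R) (x : n.-tuple R) :
  sqnorm (tuple_scale a x) = (a ^+ 2 * sqnorm x)%R.
Proof.
by rewrite /sqnorm mulr_sumr; apply: eq_bigr => i _; rewrite tnth_map exprMn.
Qed.

Lemma enorm_ge0 (x : n.-tuple R) : (0 <= enorm x)%R.
Proof. exact: sqrtr_ge0. Qed.

Lemma sqr_enorm (x : n.-tuple R) : (enorm x ^+ 2 = sqnorm x)%R.
Proof. by rewrite sqr_sqrtr// sqnorm_ge0. Qed.

Lemma enorm_scale (a : R) (x : n.-tuple R) : enorm (tuple_scale a x) = (`|a| * enorm x)%R.
Proof.
rewrite -[LHS]/(Num.sqrt (sqnorm _)) sqnorm_scale sqrtrM ?sqr_ge0//.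
by rewrite sqrtr_sqr.
Qed.

Lemma dot_scalel (a : R) (x y : n.-tuple R) : dot (tuple_scale a x) y = (a * dot x y)%R.
Proof.
by rewrite /dot mulr_sumr; apply: eq_bigr => i _; rewrite tnth_map mulrA.
Qed.

Lemma dotC (x y : n.-tuple R) : dot x y = dot y x.
Proof. by apply: eq_bigr => i _; rewrite mulrC. Qed.

(** The Cauchy-Schwarz inequality, from the sum of the squares of
x_i |y| +- y_i |x|. *)
Lemma dot_le_enorm (x y : n.-tuple R) : (`|dot x y| <= enorm x * enorm y)%R.
Proof.
set a := enorm x; set b := enorm y.
have a0 : (0 <= a)%R by exact: enorm_ge0.
have b0 : (0 <= b)%R by exact: enorm_ge0.
have sumE (s : R) : (\sum_(i < n) (tnth x i * b + s * (tnth y i * a)) ^+ 2 =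
    sqnorm x * b ^+ 2 + 2 * s * a * b * dot x y + s ^+ 2 * a ^+ 2 * sqnorm y)%R.
  rewrite /sqnorm /dot !mulr_suml !mulr_sumr -!big_split/=.
  by apply: eq_bigr => i _; ring.
have h (s : R) : (s ^+ 2 = 1 -> 0 <= (a * b) * (a * b + s * dot x y))%R.
  move=> s1; have : (0 <= \sum_(i < n) (tnth x i * b + s * (tnth y i * a)) ^+ 2)%R.
    by apply: sumr_ge0 => i _; exact: sqr_ge0.
  rewrite sumE -!sqr_enorm -/a -/b s1; lra.
have [ab0|ab0] := eqVneq (a * b)%R 0%R.
  have dot0 (u v : n.-tuple R) : enorm u = 0%R -> dot u v = 0%R.
    move=> u0; have := sqr_enorm u; rewrite u0 expr0n/= => /esym/eqP.
    rewrite /sqnorm psumr_eq0 => [|i _]; last exact: sqr_ge0.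
    move=> /allP uz; rewrite /dot big1// => i _.
    by have := uz i (mem_index_enum i); rewrite /= sqrf_eq0 => /eqP ->; rewrite mul0r.
  rewrite ab0; move/eqP: ab0; rewrite mulf_eq0 => /orP[/eqP a00|/eqP b00].
    by rewrite dot0// normr0.
  by rewrite dotC dot0// normr0.
have abp : (0 < a * b)%R by rewrite lt_neqAle eq_sym ab0 mulr_ge0.
have := h 1%R (expr1n _ _); have := h (-1)%R; rewrite sqrrN expr1n => /(_ erefl).
rewrite !pmulr_rge0// => h1 h2.
by rewrite ler_norml; apply/andP; split; lra.
Qed.

Definition cosine (x y : n.-tuple R) : R := (dot x y / (enorm x * enorm y))%R.

Lemma cosine_le1 x y : (`|cosine x y| <= 1)%R.
Proof.
rewrite normrM normfV (ger0_norm (mulr_ge0 (enorm_ge0 x) (enorm_ge0 y))).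
have [->|e0] := eqVneq (enorm x * enorm y)%R 0%R; first by rewrite invr0 mulr0.
rewrite ler_pdivrMr ?mul1r ?dot_le_enorm//.
by rewrite lt_neqAle eq_sym e0 mulr_ge0 ?enorm_ge0.
Qed.

(** When a norm vanishes the cosine is 0 by convention and so is the inner
product. *)
Lemma cosineE x y : (enorm x * enorm y * cosine x y = dot x y)%R.
Proof.
have [e0|e0] := eqVneq (enorm x * enorm y)%R 0%R; last by rewrite mulrC divfK.
rewrite e0 mul0r; have := dot_le_enorm x y; rewrite e0.
by rewrite normr_le0 => /eqP.
Qed.

Lemma cosine_scalel a x y : (0 < a)%R -> cosine (tuple_scale a x) y = cosine x y.
Proof.
move=> a0; rewrite /cosine dot_scalel enorm_scale gtr0_norm//.
by rewrite -(mulrA a (enorm x)) -mulf_div divff ?gt_eqF// mul1r.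
Qed.

Lemma cosineC x y : cosine x y = cosine y x.
Proof. by rewrite /cosine dotC (mulrC (enorm x)). Qed.

Lemma cosine_scaler a x y : (0 < a)%R -> cosine x (tuple_scale a y) = cosine x y.
Proof. by move=> a0; rewrite cosineC cosine_scalel// cosineC. Qed.

Lemma measurable_cosine :
  measurable_fun setT (fun z : n.-tuple R * n.-tuple R => cosine z.1 z.2).
Proof.
apply: measurable_funM; first exact: measurable_dot.
apply: measurable_inv_ge0; last by move=> z; rewrite mulr_ge0 ?enorm_ge0.
by apply: measurable_funM; exact: (measurableT_comp (@measurable_enorm R n)).
Qed.

Let mcos1 y : measurable_fun setT (fun x => cosine x y).
Proof. exact: (measurableT_comp measurable_cosine (pair2_measurable y)). Qed.

Let mcos2 x : measurable_fun setT (cosine x).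
Proof. exact: (measurableT_comp measurable_cosine (pair1_measurable x)). Qed.

(** The norms of two independent Gaussian vectors are jointly independent of the
cosine of their angle, which is invariant under scaling either vector. *)
Lemma integral_bipolar (F : R * R -> R -> \bar R) :
  measurable_fun setT (fun z : (R * R) * R => F z.1 z.2) ->
  (forall r u, 0 <= F r u) ->
  \int[G]_x \int[G]_y F (enorm x, enorm y) (cosine x y) =
  \int[G]_x \int[G]_y \int[G]_x' \int[G]_y' F (enorm x, enorm y) (cosine x' y').
Proof.
move=> mF F0; apply: integral_bipolar_abstract => //.
- exact: measurable_enorm.
- exact: measurable_cosine.
- move=> y H mH H0; apply: (integral_polar (mcos1 y)) => // a x.
  exact: cosine_scalel.
- move=> x H mH H0; apply: (integral_polar (mcos2 x)) => // a y.
  exact: cosine_scaler.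
Qed.

End gaussian_cosine.

Section gaussian_moments.
Context {R : realType}.
Local Open Scope ereal_scope.
Local Notation G := (@gauss_tuple R).

(** By induction on m: the integral of |x| ^ (2 m) exp (- (a ^ 2 - 1) |x| ^ 2 / 2)
scales as a ^ (- (n + 2 m)). *)
Lemma sqnorm_moment n m :
  \int[G n]_x (sqnorm x ^+ m)%:E = (2 ^+ m * rising (n%:R / 2) m)%R%:E.
Proof.
elim: m => [|m IH].
  rewrite rising0 expr0 mul1r -[RHS](integral_prob_cst (G n) 1).
  by apply: eq_integral => x _; rewrite expr0.
have mS := @measurable_sqnorm R n.
have S0 := @sqnorm_ge0 R n.
have -> : \int[G n]_x (sqnorm x ^+ m.+1)%:E =
    2%:E * \int[G n]_x (sqnorm x ^+ m * (sqnorm x / 2))%:E.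
  rewrite -ge0_integralZl//.
  - apply: eq_integral => x _; rewrite -EFinM exprSr; congr EFin; by field.
  - apply/measurable_EFinP; apply: measurable_funM; first exact: measurable_funX.
    exact: measurable_funM.
  - by move=> x _; rewrite lee_fin mulr_ge0 ?exprn_ge0// divr_ge0.
rewrite (@moment_by_scaling _ _ _ (G n) _ _ (n + m.*2)%N).
- rewrite IH -EFinM; congr EFin; rewrite /= risingS exprS natrD -muln2 natrM.
  by field.
- exact: measurable_funX.
- exact: measurable_funM.
- by move=> x; rewrite exprn_ge0.
- by move=> x; rewrite divr_ge0.
- by rewrite IH ltry.
- move=> a a1; have a0 : (0 < a)%R by rewrite (lt_trans _ a1).
  rewrite -[RHS](@gauss_tuple_scaling _ _ a) ?gt_eqF//; last 2 first.
  + by apply/measurable_EFinP; exact: measurable_funX.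
  + by move=> x; rewrite lee_fin exprn_ge0.
  rewrite -ge0_integralZl//.
  + apply: eq_integral => x _; rewrite -!EFinM; congr EFin.
    by rewrite sqnorm_scale gtr0_norm// exprMn -exprM mul2n exprD; ring.
  + apply/measurable_EFinP; apply: measurable_funM; first exact: measurable_funX.
    apply: measurableT_comp => //; apply: measurableT_comp => //.
    by apply: measurable_funM => //; exact: measurable_funM.
  + by move=> x _; rewrite lee_fin mulr_ge0 ?exprn_ge0 ?expR_ge0.
  + by rewrite lee_fin exprn_ge0// ltW.
Qed.

Lemma std_gauss_moment m :
  \int[@std_gauss R]_g ((g ^+ 2) ^+ m)%:E = (2 ^+ m * rising (1 / 2) m)%R%:E.
Proof.
rewrite -(sqnorm_moment 1 m) ge0_integral_gauss_tupleS.
- apply: eq_integral => x _; rewrite ge0_integral_gauss_tuple0.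
    by rewrite sqnorm_cons /sqnorm big_ord0 addr0.
  apply/measurable_EFinP; apply: measurable_funX.
  apply: (measurableT_comp (@measurable_sqnorm _ _)).
  apply: (measurableT_comp (@measurable_tuple_cons _ _)).
  exact: pair1_measurable.
- by apply/measurable_EFinP; apply: measurable_funX; exact: measurable_sqnorm.
- by move=> v; rewrite lee_fin exprn_ge0// sqnorm_ge0.
Qed.

Lemma dot_moment n m :
  \int[G n]_x \int[G n]_y ((dot x y ^+ 2) ^+ m)%:E =
  ((2 ^+ m * rising (1 / 2) m) * (2 ^+ m * rising (n%:R / 2) m))%R%:E.
Proof.
have mS := @measurable_sqnorm R n.
have p0 : (0 <= 2 ^+ m * rising (1 / 2) m :> R)%R.
  by rewrite mulr_ge0 ?exprn_ge0// ltW// rising_gt0.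
rewrite EFinM -sqnorm_moment -ge0_integralZl//; last 2 first.
- by apply/measurable_EFinP; exact: measurable_funX.
- by move=> x _; rewrite lee_fin exprn_ge0// sqnorm_ge0.
apply: eq_integral => x _.
transitivity (\int[G n]_y ((dot y x ^+ 2) ^+ m)%:E).
  by apply: eq_integral => y _; rewrite dotC.
rewrite (@gauss_tuple_dot _ _ x (fun t => ((t ^+ 2) ^+ m)%:E)).
- rewrite -std_gauss_moment muleC -ge0_integralZl.
  + apply: eq_integral => g _; rewrite -EFinM -exprMn; congr (_ ^+ _)%:E.
    by rewrite exprMn -[Num.sqrt _]/(enorm x) sqr_enorm.
  + by [].
  + by apply/measurable_EFinP; apply: measurable_funX; exact: measurable_funX.
  + by move=> g _; rewrite lee_fin exprn_ge0// sqr_ge0.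
  + by rewrite lee_fin exprn_ge0// sqnorm_ge0.
- by apply/measurable_EFinP; apply: measurable_funX; exact: measurable_funX.
- by move=> t; rewrite lee_fin exprn_ge0// sqr_ge0.
Qed.

Definition gauss_pair n : probability (n.-tuple R * n.-tuple R)%type R :=
  (G n) \x (G n).

Definition pair_cosine n (z : n.-tuple R * n.-tuple R) : R := cosine z.1 z.2.

(** The moment of order 2 m of the inner product is, by independence, that of the
cosine times the squares of the moments of the norms; by [dot_moment] it is also
that of a standard normal variable times the moment of one norm. *)
Lemma cosine_even_moment n m : (0 < n)%N ->
  \int[gauss_pair n]_z (pair_cosine z ^+ m.*2)%:E =
  (rising (1 / 2) m / rising (n%:R / 2) m)%:E.
Proof.
move=> n0; set M : R := (2 ^+ m * rising (n%:R / 2) m)%R.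
have n20 : (0 < n%:R / 2 :> R)%R by rewrite divr_gt0// ltr0n.
have M0 : (0 < M)%R by rewrite mulr_gt0 ?exprn_gt0// rising_gt0.
have ME : \int[G n]_x (sqnorm x ^+ m)%:E = M%:E := sqnorm_moment n m.
have mS := @measurable_sqnorm R n.
have mSm : measurable_fun setT (fun x : n.-tuple R => (sqnorm x ^+ m)%:E).
  by apply/measurable_EFinP; exact: measurable_funX.
have Sm0 (x : n.-tuple R) : 0 <= (sqnorm x ^+ m)%:E.
  by rewrite lee_fin exprn_ge0// sqnorm_ge0.
have mC : measurable_fun setT (fun z : n.-tuple R * n.-tuple R => ((pair_cosine z ^+ 2) ^+ m)%:E).
  apply/measurable_EFinP; apply: measurable_funX; apply: measurable_funX.
  exact: measurable_cosine.
pose I := \int[G n]_x \int[G n]_y ((cosine x y ^+ 2) ^+ m)%:E.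
have I0 : 0 <= I.
  by apply: integral_ge0 => x _; apply: integral_ge0 => y _; rewrite lee_fin exprn_ge0// sqr_ge0.
have -> : \int[gauss_pair n]_z (pair_cosine z ^+ m.*2)%:E = I.
  rewrite /I -(@tonelli_prod _ _ _ _ _ (G n) (G n)
    (fun x y => ((cosine x y ^+ 2) ^+ m)%:E))//.
  - by apply: eq_integral => z _; rewrite -mul2n exprM.
  - by move=> x y; rewrite lee_fin exprn_ge0// sqr_ge0.
have key : ((2 ^+ m * rising (1 / 2) m) * M)%R%:E = M%:E * (M%:E * I).
  rewrite -dot_moment.
  pose F (r : R * R) (u : R) := (((r.1 * r.2 * u) ^+ 2) ^+ m)%:E.
  transitivity (\int[G n]_x \int[G n]_y F (enorm x, enorm y) (cosine x y)).
    by apply: eq_integral => x _; apply: eq_integral => y _; rewrite /F/= cosineE.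
  rewrite integral_bipolar; last 2 first.
  - apply/measurable_EFinP; apply: measurable_funX; apply: measurable_funX.
    apply: measurable_funM => //; apply: measurable_funM.
      exact: (measurableT_comp measurable_fst measurable_fst).
    exact: (measurableT_comp measurable_snd measurable_fst).
  - by move=> r u; rewrite lee_fin exprn_ge0// sqr_ge0.
  have inner x y : \int[G n]_x' \int[G n]_y' F (enorm x, enorm y) (cosine x' y') =
      (sqnorm x ^+ m)%:E * ((sqnorm y ^+ m)%:E * I).
    rewrite muleA -EFinM.
    rewrite /I -ge0_integralZl//; last 3 first.
    - apply: (@measurable_integral_param _ _ _ _ _ (G n)
        (fun x y => ((cosine x y ^+ 2) ^+ m)%:E)) => //.
      by move=> *; rewrite lee_fin exprn_ge0// sqr_ge0.
    - by move=> x' _; apply: integral_ge0 => y' _; rewrite lee_fin exprn_ge0// sqr_ge0.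
    - by rewrite lee_fin mulr_ge0 ?exprn_ge0 ?sqnorm_ge0.
    apply: eq_integral => x' _; rewrite -ge0_integralZl//.
    - by apply: eq_integral => y' _; rewrite -EFinM /F/= -!sqr_enorm -!exprMn.
    - exact: (measurableT_comp mC (pair1_measurable x')).
    - by move=> y' _; rewrite lee_fin exprn_ge0// sqr_ge0.
    - by rewrite lee_fin mulr_ge0 ?exprn_ge0 ?sqnorm_ge0.
  transitivity (\int[G n]_x ((sqnorm x ^+ m)%:E * (M%:E * I))).
    apply: eq_integral => x _.
    rewrite -ME -ge0_integralZr// -ge0_integralZl//.
    - by apply: eq_integral => y _; rewrite inner.
    - by apply: emeasurable_funM => //; exact: measurable_cst.
    - by move=> y _; exact: mule_ge0.
  by rewrite ge0_integralZr// ?ME// mule_ge0// lee_fin ltW.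
have MK (z : \bar R) : z = (M^-1)%:E * (M%:E * z).
  by rewrite muleA -EFinM mulVf ?mul1e// gt_eqF.
rewrite [LHS]MK [_ * I]MK -key -!EFinM; congr EFin.
rewrite /M; field; rewrite expf_neq0//= gt_eqF//.
exact: rising_gt0.
Qed.

(** The reflection x -> - x preserves the Gaussian law and changes the sign of the
cosine. *)
Lemma cosine_odd_moment n m :
  \int[gauss_pair n]_z (pair_cosine z ^+ m.*2.+1)%:E = 0.
Proof.
have mC : measurable_fun setT (fun z : n.-tuple R * n.-tuple R => (pair_cosine z ^+ m.*2.+1)%R).
  by apply: measurable_funX; exact: measurable_cosine.
have opp x y : cosine (tuple_scale (-1)%R x) y = (- cosine x y :> R)%R.
  by rewrite /cosine dot_scalel enorm_scale normrN1 mul1r mulN1r mulNr.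
have sym (F : R -> \bar R) : measurable_fun setT F -> (forall t, 0 <= F t) ->
  \int[gauss_pair n]_z F (pair_cosine z) = \int[gauss_pair n]_z F (- pair_cosine z)%R.
  move=> mF F0.
  have mFc : measurable_fun setT (fun z : n.-tuple R * n.-tuple R => F (cosine z.1 z.2)).
    exact: (measurableT_comp mF (@measurable_cosine _ _)).
  have mFn : measurable_fun setT (fun z : n.-tuple R * n.-tuple R => F (- cosine z.1 z.2)%R).
    apply: (measurableT_comp mF); apply: measurableT_comp => //.
    exact: measurable_cosine.
  rewrite (@tonelli_prod _ _ _ _ _ (G n) (G n) (fun x y => F (cosine x y)))//.
  rewrite (@tonelli_prod _ _ _ _ _ (G n) (G n) (fun x y => F (- cosine x y)%R))//.
  rewrite -(@gauss_tuple_scaling _ _ (-1)%R) ?oppr_eq0 ?oner_neq0//; last 2 first.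
  - exact: measurable_integral_param.
  - by move=> x; exact: integral_ge0.
  apply: eq_integral => x _.
  rewrite normrN1 expr1n sqrrN expr1n subrr mul0r oppr0 expR0 mul1r mule1.
  by apply: eq_integral => y _; rewrite opp.
have int : (gauss_pair n).-integrable setT (fun z => (pair_cosine z ^+ m.*2.+1)%:E).
  apply: measurable_bounded_integrable => //.
    by apply: (@le_lt_trans _ _ 1); rewrite ?ltry// probability_le1.
  exists 1%R; split => // M M1 z _ /=.
  by rewrite normrX (le_trans _ (ltW M1))// exprn_ile1// cosine_le1.
have mpow : measurable_fun setT (fun t : R => (t ^+ m.*2.+1)%:E).
  by apply/measurable_EFinP; exact: measurable_funX.
rewrite integralE.
suff -> : \int[gauss_pair n]_z ((fun z => (pair_cosine z ^+ m.*2.+1)%:E)^\+ z) =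
    \int[gauss_pair n]_z ((fun z => (pair_cosine z ^+ m.*2.+1)%:E)^\- z).
  by apply: subee; exact: integrable_neg_fin_num.
transitivity (\int[gauss_pair n]_z (fun t : R => (t ^+ m.*2.+1)%:E)^\+ (pair_cosine z)).
  by apply: eq_integral => z _; rewrite !funeposE.
rewrite sym; last 2 first.
- exact: measurable_funepos.
- by move=> t; exact: funepos_ge0.
apply: eq_integral => z _; rewrite funeposE funenegE; congr maxe.
by rewrite -EFinN exprS -mul2n exprM sqrrN -exprM mulNr -exprS.
Qed.

End gaussian_moments.

(** * A Chu-Vandermonde identity and the even moments of a chord *)

Section chu_vandermonde.
Context {R : realFieldType}.
Implicit Types (c x z X Z : R).

Lemma rising_recl c l : rising c l.+1 = c * rising (c + 1) l.
Proof.
rewrite /rising big_ord_recl addr0; congr (_ * _).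
by apply: eq_bigr => i _; rewrite lift0 -natr1; ring.
Qed.

Lemma risingD c m n : rising c (m + n) = rising c m * rising (c + m%:R) n.
Proof.
rewrite /rising big_split_ord/=; congr (_ * _).
by apply: eq_bigr => i _; rewrite natrD addrA.
Qed.

(** Duplication: 4 ^ m m! (1/2)_m = (2 m)! *)
Lemma rising_half m : rising (1 / 2) m * (4 ^+ m * m`!%:R) = (m.*2)`!%:R :> R.
Proof.
elim: m => [|m IH]; first by rewrite rising0 expr0 !mul1r.
rewrite risingS doubleS !factS !natrM -IH exprS -!natr1 -muln2 natrM; by field.
Qed.

(** Denote the left-hand side by S(a, b, c). Pascal's rule gives
S(a + 1, b, c) = S(a, b, c) + (b / c) S(a, b - 1, c + 1), and the right-hand side
satisfies the same recursion. *)
Lemma chu_vandermonde c (a b : nat) : 0 < c ->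
  \sum_(m < a.+1) 'C(a, m)%:R * 'C(b, m)%:R * m`!%:R / rising c m =
  rising (c + b%:R) a / rising c a.
Proof.
elim: a b c => [|a IH] b c c0.
  by rewrite big_ord1 !rising0 !bin0 !mulr1.
have r0 k (e : R) : 0 < e -> rising e k != 0 by move=> e0; rewrite gt_eqF ?rising_gt0.
have -> : \sum_(m < a.+2) 'C(a.+1, m)%:R * 'C(b, m)%:R * m`!%:R / rising c m =
    \sum_(m < a.+1) 'C(a, m)%:R * 'C(b, m)%:R * m`!%:R / rising c m +
    \sum_(m < a.+1) 'C(a, m)%:R * 'C(b, m.+1)%:R * m.+1`!%:R / rising c m.+1.
  rewrite big_ord_recl [X in _ = X + _]big_ord_recl !bin0 -addrA; congr (_ + _).
  have -> : \sum_(i < a) 'C(a, lift ord0 i)%:R * 'C(b, lift ord0 i)%:R *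
      (lift ord0 i)`!%:R / rising c (lift ord0 i) =
     \sum_(i < a.+1) 'C(a, i.+1)%:R * 'C(b, i.+1)%:R * (i.+1)`!%:R / rising c i.+1.
    by rewrite [RHS]big_ord_recr/= bin_small// !mul0r addr0.
  rewrite -big_split/=; apply: eq_bigr => i _.
  by rewrite /bump/= add1n binS natrD !mulrDl.
rewrite IH//.
have -> : \sum_(m < a.+1) 'C(a, m)%:R * 'C(b, m.+1)%:R * m.+1`!%:R / rising c m.+1 =
    b%:R / c * (rising (c + b%:R) a / rising (c + 1) a).
  case: b => [|b].
    by rewrite !mul0r big1// => i _; rewrite bin0n mulr0 !mul0r.
  have -> : c + b.+1%:R = (c + 1) + b%:R by rewrite -natr1; ring.
  rewrite -IH ?addr_gt0// mulr_sumr; apply: eq_bigr => i _.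
  have h : b.+1%:R * 'C(b, i)%:R = i.+1%:R * 'C(b.+1, i.+1)%:R :> R.
    by rewrite -!natrM -(mul_bin_diag b.+1 i).
  rewrite rising_recl factS natrM.
  have -> : 'C(a, i)%:R * 'C(b.+1, i.+1)%:R * (i.+1%:R * i`!%:R) / (c * rising (c + 1) i) =
    'C(a, i)%:R * (i.+1%:R * 'C(b.+1, i.+1)%:R) * i`!%:R / (c * rising (c + 1) i) by ring.
  rewrite -h; field.
  by rewrite (gt_eqF c0) r0// addr_gt0.
have e : c * rising (c + 1) a = rising c a * (c + a%:R) by rewrite -rising_recl risingS.
have ca : c + a%:R != 0 by rewrite gt_eqF// ltr_pwDl.
have -> : rising (c + 1) a = rising c a * (c + a%:R) / c by rewrite -e mulrC mulKf// gt_eqF.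
rewrite !risingS; field.
by rewrite ca (gt_eqF c0) r0.
Qed.

(** The right-hand side expanded by the binomial theorem. The coefficient at
X ^ a Z ^ (l - a), with a = m + i, is l! / (m! i! (l - 2 m - i)!), which the
left-hand side writes in a form that makes sense for all a. *)
Lemma sum_bin_shift (X Z : R) (l m : nat) :
  \sum_(a < l.+1) ('C(l, a) * 'C(a, m) * 'C(l - a, m) * m`!)%:R * (X ^+ a * Z ^+ (l - a)) =
  ('C(l, m.*2) * m.*2`!)%:R / m`!%:R * ((X * Z) ^+ m * (X + Z) ^+ (l - m.*2)).
Proof.
have [lm|ml] := ltnP l m.*2.
  rewrite (bin_small lm) mul0n !mul0r big1// => a _.
  have [am|ma] := ltnP a m; first by rewrite (bin_small am) muln0 !mul0n mul0r.
  have h : (l - a < m)%N by rewrite ltn_subLR -?addnn ?leq_ltn_add// -ltnS// ltnS; lia.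
  by rewrite (bin_small h) muln0 mul0n mul0r.
have [k lE] : exists k, l = (m.*2 + k)%N by exists (l - m.*2)%N; rewrite subnKC.
subst l.
have nz n : n`!%:R != 0 :> R by rewrite pnatr_eq0 -lt0n fact_gt0.
rewrite -(big_mkord xpredT (fun a => ('C(m.*2 + k, a) * 'C(a, m) * 'C(m.*2 + k - a, m) * m`!)%:R *
  (X ^+ a * Z ^+ (m.*2 + k - a)))).
rewrite (@big_cat_nat _ _ _ m)//=; last by lia.
rewrite (@big_cat_nat _ _ _ (m + k).+1 m)/=; [|lia|lia].
rewrite big_nat big1 ?add0r; last first.
  by move=> a /andP[_ am]; rewrite (bin_small am) muln0 !mul0n mul0r.
rewrite [X in _ + X]big_nat [X in _ + X]big1 ?addr0; last first.
  move=> a /andP[am al].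
  have h : (m.*2 + k - a < m)%N by lia.
  by rewrite (bin_small h) muln0 mul0n mul0r.
rewrite -{1}(add0n m) (_ : (m + k).+1 = (k.+1 + m)%N); last by lia.
rewrite big_addn addnK big_mkord.
rewrite addrC exprDn !mulr_sumr.
rewrite (_ : (m.*2 + k - m.*2)%N = k); last by lia.
apply: eq_bigr => i _.
have ik : (i <= k)%N by rewrite -ltnS.
rewrite (_ : (m.*2 + k - (i + m))%N = (k - i + m)%N); last by lia.
have coef : ('C(m.*2 + k, i + m) * 'C(i + m, m) * 'C(k - i + m, m) * m`!)%:R =
   ('C(m.*2 + k, m.*2) * (m.*2)`!)%:R / m`!%:R * 'C(k, i)%:R :> R.
  have f n j : (j <= n)%N -> 'C(n, j)%:R = n`!%:R / (j`!%:R * (n - j)`!%:R) :> R.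
    by move=> jn; rewrite -(bin_fact jn) !natrM; field; rewrite !nz.
  rewrite !natrM !f//; try lia.
  rewrite (_ : (m.*2 + k - (i + m))%N = (k - i + m)%N); last by lia.
  rewrite (_ : (i + m - m)%N = i); last by lia.
  rewrite (_ : (k - i + m - m)%N = (k - i)%N); last by lia.
  rewrite (_ : (m.*2 + k - m.*2)%N = k); last by lia.
  by field; rewrite !nz.
rewrite coef -mulrnAl -mulr_natr -!mulrA; congr (_ * (_ * _)).
by rewrite !exprD exprMn; ring.
Qed.

Lemma sum_even_odd (f : nat -> R) N :
  \sum_(j < N.*2) f j = \sum_(m < N) (f m.*2 + f m.*2.+1).
Proof.
elim: N => [|N IH]; first by rewrite !big_ord0.
by rewrite doubleS !big_ord_recr/= IH addrA.
Qed.

(** With u_j the moments of the cosine U, the left-hand side is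
E (x ^ 2 + z ^ 2 + 2 x z U) ^ l. Its coefficient at x ^ (2 a) z ^ (2 (l - a)) is
binom(l, a) times a sum evaluated by [chu_vandermonde]. *)
Lemma moment_expansion c (u : nat -> R) x z l : 0 < c ->
  (forall m, u m.*2 = rising (1 / 2) m / rising c m) ->
  (forall m, u m.*2.+1 = 0) ->
  \sum_(j < l.+1) 'C(l, j)%:R * (x ^+ 2 + z ^+ 2) ^+ (l - j) * (2 * x * z) ^+ j * u j =
  \sum_(a < l.+1) 'C(l, a)%:R * (rising c l / (rising c a * rising c (l - a))) *
    ((x ^+ 2) ^+ a * (z ^+ 2) ^+ (l - a)).
Proof.
move=> c0 ue uo.
have r0 k : rising c k != 0 by rewrite gt_eqF ?rising_gt0.
have nz n : n`!%:R != 0 :> R by rewrite pnatr_eq0 -lt0n fact_gt0.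
set f := fun j => 'C(l, j)%:R * (x ^+ 2 + z ^+ 2) ^+ (l - j) * (2 * x * z) ^+ j * u j.
have -> : \sum_(j < l.+1) f j = \sum_(j < l.+1.*2) f j.
  rewrite -!(big_mkord xpredT f) [RHS](@big_cat_nat _ _ _ l.+1)//=; last by lia.
  rewrite [X in _ + X]big_nat [X in _ + X]big1 ?addr0// => j /andP[lj _].
  by rewrite /f bin_small// !mul0r.
rewrite sum_even_odd.
transitivity (\sum_(m < l.+1) (rising c m)^-1 *
   \sum_(a < l.+1) ('C(l, a) * 'C(a, m) * 'C(l - a, m) * m`!)%:R *
      ((x ^+ 2) ^+ a * (z ^+ 2) ^+ (l - a))).
  apply: eq_bigr => m _; rewrite sum_bin_shift /f uo mulr0 addr0 ue.
  rewrite natrM -rising_half.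
  rewrite -mul2n exprM (_ : (2 * x * z) ^+ 2 = 4 * (x ^+ 2 * z ^+ 2)); last by ring.
  rewrite (exprMn _ 4); set W := (x ^+ 2 + z ^+ 2) ^+ _; set V := (x ^+ 2 * z ^+ 2) ^+ m; field.
  by rewrite r0 nz.
under eq_bigr do rewrite mulr_sumr.
rewrite exchange_big/=; apply: eq_bigr => a _.
have al : (a <= l)%N by rewrite -ltnS.
have -> : \sum_(m < l.+1) (rising c m)^-1 *
      (('C(l, a) * 'C(a, m) * 'C(l - a, m) * m`!)%:R * ((x ^+ 2) ^+ a * (z ^+ 2) ^+ (l - a))) =
    'C(l, a)%:R * (\sum_(m < l.+1) 'C(a, m)%:R * 'C(l - a, m)%:R * m`!%:R / rising c m) *
      ((x ^+ 2) ^+ a * (z ^+ 2) ^+ (l - a)).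
  rewrite mulr_sumr mulr_suml; apply: eq_bigr => m _; rewrite !natrM; ring.
congr (_ * _ * _).
have -> : \sum_(m < l.+1) 'C(a, m)%:R * 'C(l - a, m)%:R * m`!%:R / rising c m =
   \sum_(m < a.+1) 'C(a, m)%:R * 'C(l - a, m)%:R * m`!%:R / rising c m.
  rewrite -!(big_mkord xpredT (fun m => 'C(a, m)%:R * 'C(l - a, m)%:R * m`!%:R / rising c m)).
  rewrite (@big_cat_nat _ _ _ a.+1)//= [X in _ + X]big_nat [X in _ + X]big1 ?addr0//.
  by move=> m /andP[am _]; rewrite bin_small// !mul0r.
rewrite chu_vandermonde//.
have -> : rising c l = rising c (l - a) * rising (c + (l - a)%:R) a. by rewrite -risingD subnK.
by field; rewrite !r0.
Qed.

End chu_vandermonde.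

(** * The product formula for Bessel series *)

Section exponentially_dominated_series.
Context {R : realType}.
Implicit Types (f g : nat -> R) (A B : R).

(** This domination makes all the interchanges of limits below uniform: partial
sums are bounded by exp B. *)
Definition exp_dominated f B := forall l, `|f l| <= B ^+ l / l`!%:R.

Lemma exp_coeff_ge0 B l : 0 <= B -> 0 <= B ^+ l / l`!%:R.
Proof. by move=> B0; rewrite divr_ge0// exprn_ge0. Qed.

Lemma exp_dominated_cvg f B : 0 <= B -> exp_dominated f B -> cvgn (series f).
Proof.
move=> B0 fB; apply: normed_cvg.
apply: (series_le_cvg _ _ fB) => //; first by move=> l; exact: exp_coeff_ge0.
exact: is_cvg_series_exp_coeff.
Qed.

Lemma exp_dominated_series_le f B n : 0 <= B -> exp_dominated f B ->
  `|series f n| <= expR B.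
Proof.
move=> B0 fB; rewrite /series/= (le_trans (ler_norm_sum _ _ _))//.
apply: (@le_trans _ _ (series (exp_coeff B) n)).
  by apply: ler_sum => i _; exact: fB.
apply: nondecreasing_cvgn_le; last exact: is_cvg_series_exp_coeff.
by apply: nondecreasing_series => l _ _; exact: exp_coeff_ge0.
Qed.

(** Summation along antidiagonals. *)
Lemma triangular_sum f g n :
  \sum_(l < n) \sum_(a < l.+1) f a * g (l - a)%N =
  \sum_(a < n) \sum_(b < n | (a + b < n)%N) f a * g b.
Proof.
transitivity (\sum_(l < n) \sum_(a < n | (a <= l)%N) f a * g (l - a)%N).
  by apply: eq_bigr => l _; rewrite (big_ord_widen n (fun a => f a * g (l - a)%N)).
rewrite (exchange_big_dep xpredT)//=; apply: eq_bigr => a _.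
transitivity (\sum_(a <= l < n) f a * g (l - a)%N); first by rewrite big_geq_mkord.
rewrite -(big_mkord (fun b => (a + b < n)%N) (fun b => f a * g b)).
rewrite -{1}(add0n a) big_addn.
under eq_bigr do rewrite addnK.
have -> : \sum_(0 <= b < n | (a + b < n)%N) f a * g b =
  \sum_(0 <= b < n - a) f a * g b.
  rewrite !big_mkord (big_ord_widen n (fun b => f a * g b)) ?leq_subr//.
  by apply: eq_bigl => b; rewrite ltn_subRL.
by [].
Qed.

Lemma exp_convolution A B l :
  \sum_(a < l.+1) (A ^+ a / a`!%:R) * (B ^+ (l - a) / (l - a)`!%:R) =
  (A + B) ^+ l / l`!%:R.
Proof.
have nz n : n`!%:R != 0 :> R by rewrite pnatr_eq0 -lt0n fact_gt0.
rewrite addrC exprDn mulr_suml; apply: eq_bigr => a _.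
have al : (a <= l)%N by rewrite -ltnS.
rewrite -mulr_natr -(bin_fact al) !natrM; field.
by rewrite !nz pnatr_eq0 -lt0n bin_gt0.
Qed.

(** The difference between the product of the partial sums and the partial sum of
the Cauchy product runs over the pairs a, b < n with a + b >= n. It is dominated
by the same difference for the exponential series at A and B, which tends to
exp A exp B - exp (A + B) = 0. *)
Lemma cauchy_product f g A B : 0 <= A -> 0 <= B ->
  exp_dominated f A -> exp_dominated g B ->
  series (fun l => \sum_(a < l.+1) f a * g (l - a)%N) @ \oo -->
  limn (series f) * limn (series g).
Proof.
move=> A0 B0 fA gB.
pose T (u v : nat -> R) n := series (fun l => \sum_(a < l.+1) u a * v (l - a)%N) n.
pose D u v n := series u n * series v n - T u v n.
have DE u v n : D u v n = \sum_(a < n) \sum_(b < n | ~~ (a + b < n)%N) u a * v b.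
  rewrite /D /T /series/= !big_mkord triangular_sum.
  have -> : (\sum_(i < n) u i) * (\sum_(i < n) v i) = \sum_(a < n) \sum_(b < n) u a * v b.
    by rewrite mulr_suml; apply: eq_bigr => a _; rewrite mulr_sumr.
  rewrite -sumrB; apply: eq_bigr => a _.
  by rewrite [X in X - _](bigID (fun b : 'I_n => (a + b < n)%N))/= addrAC subrr add0r.
pose eA := exp_coeff A; pose eB := exp_coeff B.
have D_le n : `|D f g n| <= D eA eB n.
  rewrite !DE (le_trans (ler_norm_sum _ _ _))//; apply: ler_sum => a _.
  rewrite (le_trans (ler_norm_sum _ _ _))//; apply: ler_sum => b _.
  by rewrite normrM ler_pM// ?fA ?gB.
have De : D eA eB @ \oo --> 0.
  rewrite -(subrr (expR (A + B))) {1}expRD.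
  apply: cvgB; first by apply: cvgM; exact: is_cvg_series_exp_coeff.
  rewrite (_ : T eA eB = series (exp_coeff (A + B))); first exact: is_cvg_series_exp_coeff.
  apply/funext => n; rewrite /T /series/=; apply: eq_bigr => l _.
  exact: exp_convolution.
have Df : D f g @ \oo --> 0.
  apply: norm_cvg0; apply: (@squeeze_cvgr _ _ _ _ (fun=> 0) (D eA eB)) => //.
    by apply: nearW => n; rewrite normr_ge0 D_le.
  exact: cvg_cst.
rewrite (_ : series _ = (fun n => series f n * series g n - D f g n)); last first.
  by apply/funext => n; rewrite /D opprB addrCA subrr addr0.
rewrite -[X in _ --> X]subr0; apply: cvgB => //.
by apply: cvgM; [exact: exp_dominated_cvg A0 fA|exact: exp_dominated_cvg B0 gB].
Qed.

Context d (T : measurableType d) (Q : probability T R).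

Lemma bounded_integrable (h : T -> R) (K : R) : measurable_fun setT h ->
  (forall w, `|h w| <= K) -> Q.-integrable setT (EFin \o h).
Proof.
move=> mh hK; apply: measurable_bounded_integrable => //.
  by apply: (@le_lt_trans _ _ 1%E); rewrite ?ltry// probability_le1.
by exists K; split => [|M KM]; rewrite ?num_real// => w _ /=; rewrite (le_trans (hK w))// ltW.
Qed.

Lemma measurable_series (g : nat -> T -> R) n : (forall l, measurable_fun setT (g l)) ->
  measurable_fun setT (fun w => series (g ^~ w) n).
Proof. by move=> mg; rewrite /series/=; exact: measurable_sum. Qed.

Lemma integral_series (g : nat -> T -> R) (e : nat -> R) B : 0 <= B ->
  (forall l, measurable_fun setT (g l)) -> (forall w, exp_dominated (g ^~ w) B) ->
  (forall l, \int[Q]_w (g l w)%:E = (e l)%:E)%E ->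
  (\int[Q]_w (limn (series (g ^~ w)))%:E)%E = (limn (series e))%:E.
Proof.
move=> B0 mg gB ge.
have sc w : series (g ^~ w) @ \oo --> limn (series (g ^~ w)).
  exact: exp_dominated_cvg B0 (gB w).
have lim_le w : `|limn (series (g ^~ w))| <= expR B.
  have h : `|series (g ^~ w) n| @[n --> \oo] --> `|limn (series (g ^~ w))|.
    by apply: cvg_norm; exact: sc.
  rewrite -(cvg_lim _ h)//.
  apply: limr_le; first by apply/cvg_ex; eexists; exact: h.
  by apply: nearW => n; exact: exp_dominated_series_le _ B0 (gB w).
have mlim : measurable_fun setT (fun w => limn (series (g ^~ w))).
  apply: (measurable_fun_cvg (h := fun n w => series (g ^~ w) n)) => //.
  by move=> n; exact: measurable_series.
have int_s n : (\int[Q]_w (series (g ^~ w) n)%:E)%E = (series e n)%:E.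
  rewrite /series/= -sumEFin -(eq_bigr _ (fun i _ => ge i)) -integral_sum//.
    by apply: eq_integral => w _; rewrite sumEFin.
  move=> l; apply: (bounded_integrable (K := B ^+ l / l`!%:R)) => // w.
  exact: gB.
have cv : (series e n)%:E @[n --> \oo] --> (\int[Q]_w (limn (series (g ^~ w)))%:E)%E.
  under eq_fun do rewrite -int_s.
  apply: (@dominated_cvg _ _ _ Q _ measurableT _ _ (cst (expR B)%:E)) => //.
  - by move=> n; apply/measurable_EFinP; exact: measurable_series.
  - by move=> w _; apply: cvg_EFin; [exact: nearW|exact: sc].
  - by apply: (bounded_integrable (h := cst (expR B)) (K := expR B)) => // w; rewrite ger0_norm ?expR_ge0.
  - by move=> n w _; rewrite lee_fin; exact: exp_dominated_series_le _ B0 (gB w).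
have fin : (\int[Q]_w (limn (series (g ^~ w)))%:E)%E \is a fin_num.
  by apply: integrable_fin_num => //; exact: (bounded_integrable mlim lim_le).
rewrite -(fineK fin) in cv *; congr EFin; apply/esym/cvg_lim => //.
exact: fine_cvg cv.
Qed.

End exponentially_dominated_series.

Section bessel_series.
Context {R : realType}.
Implicit Types (c t x y z : R).

Definition bessel_coeff c t (l : nat) : R :=
  (-1) ^+ l / (rising c l * l`!%:R) * (t / 2) ^+ l.*2.

(** The spherical Bessel function of index c - 1. *)
Definition bessel c t : R := limn (series (bessel_coeff c t)).

Lemma sphBesselE N t : (0 < N)%N -> sphBessel (N%:R / 2 - 1) t = bessel (N%:R / 2) t.
Proof.
move=> N0; rewrite /sphBessel /bessel; congr (limn (series _)); apply/funext => l.
by rewrite subrK pochhammer_half.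
Qed.

Lemma rising_ge c l : 1 / 2 <= c -> 1 <= 4 ^+ l * rising c l.
Proof.
move=> hc; elim: l => [|l IH]; first by rewrite rising0 mulr1.
have l0 : 0 <= l%:R :> R by [].
by rewrite risingS exprSr mulrACA mulr_ege1//; lra.
Qed.

Lemma bessel_coeff_dominated c t : 1 / 2 <= c -> exp_dominated (bessel_coeff c t) (t ^+ 2).
Proof.
move=> hc l; have c0 : 0 < c by rewrite (lt_le_trans _ hc).
have r0 := rising_gt0 l c0.
have l0 : 0 < l`!%:R :> R by rewrite ltr0n fact_gt0.
rewrite /bessel_coeff -mul2n exprM normrM [X in _ * X]ger0_norm; last first.
  by apply: exprn_ge0; exact: sqr_ge0.
rewrite normrM normrX normrN1 expr1n mul1r gtr0_norm ?invr_gt0 ?mulr_gt0//.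
have p0 : 0 < 4 ^+ l * rising c l by rewrite mulr_gt0// exprn_gt0.
have -> : (rising c l * l`!%:R)^-1 * ((t / 2) ^+ 2) ^+ l =
    ((t ^+ 2) ^+ l / l`!%:R) / (4 ^+ l * rising c l).
  rewrite (_ : (t / 2) ^+ 2 = t ^+ 2 / 4); last by field.
  rewrite expr_div_n; field.
  by rewrite !gt_eqF// exprn_gt0.
by rewrite ler_pdivrMr// ler_peMr ?rising_ge// exp_coeff_ge0// sqr_ge0.
Qed.

Lemma measurable_bessel c : 1 / 2 <= c -> measurable_fun setT (bessel c).
Proof.
move=> hc.
apply: (measurable_fun_cvg (h := fun n t => series (bessel_coeff c t) n)) => //.
- move=> n; rewrite /series/=; apply: measurable_sum => l.
  apply: measurable_funM => //; apply: measurable_funX.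
  exact: measurable_funM.
- by move=> t _; apply: (exp_dominated_cvg (sqr_ge0 t)); exact: bessel_coeff_dominated.
Qed.

Context d (T : measurableType d) (Q : probability T R) (U : T -> R) (c : R).
Hypothesis mU : measurable_fun setT U.
Hypothesis U1 : forall w, `|U w| <= 1.
Hypothesis hc : 1 / 2 <= c.
Hypothesis U_even : forall m,
  (\int[Q]_w (U w ^+ m.*2)%:E = (rising (1 / 2) m / rising c m)%:E)%E.
Hypothesis U_odd : forall m, (\int[Q]_w (U w ^+ m.*2.+1)%:E = 0)%E.

Let c0 : 0 < c. Proof. by rewrite (lt_le_trans _ hc). Qed.

Let r0 k : rising c k != 0. Proof. by rewrite gt_eqF ?rising_gt0. Qed.

Let nz n : n`!%:R != 0 :> R. Proof. by rewrite pnatr_eq0 -lt0n fact_gt0. Qed.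

(** Term by term integration of the cosine series: (1/2)_m / (2 m)! is
1 / (4 ^ m m!). *)
Lemma bessel_cos t : (\int[Q]_w (cos (t * U w))%:E = (bessel c t)%:E)%E.
Proof.
have t20 := sqr_ge0 t.
rewrite -(@integral_series _ _ _ Q (fun l w => cos_coeff' (t * U w) l) _ (t ^+ 2))//.
- apply: eq_integral => w _; congr EFin; apply/esym/cvg_lim => //.
  exact: cvg_cos_coeff'.
- move=> l; rewrite /cos_coeff'; apply: measurable_funM => //.
  apply: measurable_funM => //; apply: measurable_funX; exact: measurable_funM.
- move=> w l; rewrite /cos_coeff' -exprnP -mul2n exprM normrM normfV normr_nat.
  rewrite normrM normrX normrN1 expr1n mul1r ger0_norm; last first.
    by apply: exprn_ge0; exact: sqr_ge0.
  apply: ler_pM => //.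
  + by apply: exprn_ge0; exact: sqr_ge0.
  + rewrite lerXn2r ?nnegrE ?sqr_ge0// exprMn ler_piMr ?sqr_ge0//.
    by rewrite -real_normK ?num_real// exprn_ile1.
  + rewrite lef_pV2 ?posrE ?ltr0n ?fact_gt0// ler_nat.
    by rewrite leq_fact// leq_pmull.
- move=> l.
  transitivity (\int[Q]_w (((-1) ^+ l * t ^+ l.*2 / (l.*2)`!%:R)%:E * (U w ^+ l.*2)%:E))%E.
    apply: eq_integral => w _; rewrite -EFinM; congr EFin.
    by rewrite /cos_coeff' -exprnP exprMn; ring.
  rewrite integralZl//; last first.
    apply: (@bounded_integrable _ _ _ Q _ 1); first exact: measurable_funX.
    by move=> w; rewrite normrX exprn_ile1.
  rewrite U_even -EFinM; congr EFin; rewrite /bessel_coeff -rising_half.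
  rewrite expr_div_n -(mul2n l) !exprM (_ : 2 ^+ 2 = 4); last by ring.
  have r1 : rising (1 / 2) l != 0 :> R by rewrite gt_eqF// rising_gt0.
  have f0 : 4 ^+ l != 0 :> R by rewrite expf_neq0.
  by field; rewrite r0 nz r1 f0.
Qed.

(** As an average of cosines. *)
Lemma bessel_le1 t : `|bessel c t| <= 1.
Proof.
have mcos : measurable_fun setT (fun w => cos (t * U w)).
  apply: (measurableT_comp (f := @cos R)); last exact: measurable_funM.
  by apply: continuous_measurable_fun; exact: continuous_cos.
rewrite -lee_fin -[(`|bessel c t|)%:E]abse_EFin -bessel_cos.
apply: le_trans (le_abse_integral _ _ _) _ => //.
  by apply/measurable_EFinP.
rewrite -[leRHS](integral_prob_cst Q 1%E); apply: ge0_le_integral => //.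
  by apply: measurableT_comp => //; exact/measurable_EFinP.
by move=> w _; rewrite /= lee_fin cos_max.
Qed.

Let W x z w : R := x ^+ 2 + z ^+ 2 + 2 * x * z * U w.

Lemma sqr_sum_cosine_ge0 x z w : 0 <= x -> 0 <= z -> 0 <= W x z w.
Proof.
move=> x0 z0; have := U1 w; rewrite ler_norml => /andP[h1 h2].
have xz : 0 <= x * z by exact: mulr_ge0.
have := sqr_ge0 (x - z); rewrite /W sqrrB; nra.
Qed.

Lemma sqr_sum_cosine_le x z w : 0 <= x -> 0 <= z -> W x z w <= (x + z) ^+ 2.
Proof.
move=> x0 z0; have := U1 w; rewrite ler_norml => /andP[h1 h2].
have xz : 0 <= x * z by exact: mulr_ge0.
by rewrite /W sqrrD; nra.
Qed.

Let mW x z : measurable_fun setT (W x z).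
Proof. by apply: measurable_funD => //; exact: measurable_funM. Qed.

Let integral_WX x z l : (\int[Q]_w (W x z w ^+ l)%:E =
  (\sum_(a < l.+1) 'C(l, a)%:R * (rising c l / (rising c a * rising c (l - a))) *
    ((x ^+ 2) ^+ a * (z ^+ 2) ^+ (l - a)))%:E)%E.
Proof.
pose u j := fine (\int[Q]_w (U w ^+ j)%:E)%E.
have iU j : Q.-integrable setT (fun w => (U w ^+ j)%:E).
  apply: (@bounded_integrable _ _ _ Q _ 1); first exact: measurable_funX.
  by move=> w; rewrite normrX exprn_ile1.
have uE j : (\int[Q]_w (U w ^+ j)%:E = (u j)%:E)%E.
  by rewrite fineK//; exact: integrable_fin_num.
rewrite -(@moment_expansion _ c u)//; last 2 first.
- by move=> m; rewrite /u U_even.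
- by move=> m; rewrite /u U_odd.
rewrite -sumEFin.
transitivity (\int[Q]_w \sum_(j < l.+1)
   (('C(l, j)%:R * (x ^+ 2 + z ^+ 2) ^+ (l - j) * (2 * x * z) ^+ j)%:E * (U w ^+ j)%:E))%E.
  apply: eq_integral => w _; rewrite /W exprDn -sumEFin; apply: eq_bigr => j _.
  by rewrite -EFinM; congr EFin; rewrite exprMn -mulr_natr; ring.
rewrite integral_sum//; last by move=> j; apply: integrableZl.
by apply: eq_bigr => j _; rewrite integralZl// uE -EFinM.
Qed.

(** Integrate the series of the left-hand side term by term; [moment_expansion]
turns its terms into those of the Cauchy product of the series on the right. *)
Lemma bessel_product x y z : 0 <= x -> 0 <= z ->
  (\int[Q]_w (bessel c (y * Num.sqrt (W x z w)))%:E =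
   (bessel c (x * y) * bessel c (z * y))%:E)%E.
Proof.
move=> x0 z0.
pose e l := \sum_(a < l.+1) bessel_coeff c (x * y) a * bessel_coeff c (z * y) (l - a)%N.
have <- : limn (series e) = bessel c (x * y) * bessel c (z * y).
  apply/cvg_lim => //.
  by apply: (cauchy_product (sqr_ge0 (x * y)) (sqr_ge0 (z * y))); exact: bessel_coeff_dominated.
pose B := y ^+ 2 * (x + z) ^+ 2.
rewrite -(@integral_series _ _ _ Q (fun l w => bessel_coeff c (y * Num.sqrt (W x z w)) l) _ B)//.
- by rewrite mulr_ge0 ?sqr_ge0.
- move=> l; rewrite /bessel_coeff; apply: measurable_funM => //.
  apply: measurable_funX; apply: measurable_funM => //; apply: measurable_funM => //.
  apply: (measurableT_comp (f := @Num.sqrt R)) => //.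
  by apply: continuous_measurable_fun; exact: sqrt_continuous.
- move=> w l; apply: (le_trans (bessel_coeff_dominated _ hc l)).
  rewrite ler_wpM2r ?invr_ge0// lerXn2r ?nnegrE ?sqr_ge0//.
    by rewrite mulr_ge0 ?sqr_ge0.
  rewrite exprMn sqr_sqrtr ?sqr_sum_cosine_ge0// ler_wpM2l ?sqr_ge0//.
  exact: sqr_sum_cosine_le.
- move=> l.
  transitivity (\int[Q]_w (((-1) ^+ l / (rising c l * l`!%:R) * (y / 2) ^+ l.*2)%:E * (W x z w ^+ l)%:E))%E.
    apply: eq_integral => w _; rewrite -EFinM; congr EFin.
    rewrite /bessel_coeff -[in RHS](sqr_sqrtr (sqr_sum_cosine_ge0 w x0 z0)) -exprM mul2n.
    by rewrite !exprMn; ring.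
  rewrite integralZl//; last first.
    apply: (@bounded_integrable _ _ _ Q _ (((x + z) ^+ 2) ^+ l)); first exact: measurable_funX.
    move=> w; rewrite ger0_norm ?exprn_ge0 ?sqr_sum_cosine_ge0//.
    by rewrite lerXn2r ?nnegrE ?sqr_ge0 ?sqr_sum_cosine_ge0 ?sqr_sum_cosine_le.
  rewrite integral_WX -EFinM; congr EFin; rewrite mulr_sumr; apply: eq_bigr => a _.
  have al : (a <= l)%N by rewrite -ltnS.
  rewrite /bessel_coeff -(bin_fact al) !natrM -!exprM !mul2n.
  have s1 : (-1) ^+ l = (-1) ^+ a * (-1) ^+ (l - a) :> R by rewrite -exprD subnKC.
  have s2 : (y / 2) ^+ l.*2 = (y / 2) ^+ a.*2 * (y / 2) ^+ (l - a).*2.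
    by rewrite -exprD -doubleD subnKC.
  have b0 : 'C(l, a)%:R != 0 :> R by rewrite pnatr_eq0 -lt0n bin_gt0.
  rewrite s1 s2 -!(mulrA _ y) !(exprMn _ _ (y / 2)).
  by field; rewrite !r0 !nz b0.
Qed.

End bessel_series.

(** * Almost sure uniqueness of regular conditional distributions *)

Section image_probability_integrals.
Local Open Scope ereal_scope.
Context d1 d2 (T1 : measurableType d1) (T2 : measurableType d2) (R : realType).
Context (P : probability T1 R) (f : T1 -> T2).
Hypothesis mf : measurable_fun setT f.

Lemma ge0_integral_image_prob_in (D : set T2) (g : T2 -> \bar R) : measurable D ->
  measurable_fun setT g -> (forall y, 0 <= g y) ->
  \int[image_prob P mf]_(y in D) g y = \int[P]_(x in f @^-1` D) g (f x).
Proof.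
move=> mD mg g0; rewrite /image_prob /distribution ge0_integral_pushforward//.
exact: measurable_funTS.
Qed.

Lemma integral_image_prob (g : T2 -> \bar R) : measurable_fun setT g ->
  P.-integrable setT (g \o f) ->
  \int[image_prob P mf]_y g y = \int[P]_x g (f x).
Proof. by move=> mg ig; rewrite /image_prob integral_distribution. Qed.

Lemma ae_image_prob (S : set T2) : (\forall y \ae image_prob P mf, S y) ->
  \forall x \ae P, S (f x).
Proof.
move=> [N [mN N0 SN]]; exists (f @^-1` N); split.
- by rewrite -[X in measurable X]setTI; exact: mf.
- exact: N0.
- by move=> x /=; exact: SN.
Qed.

End image_probability_integrals.

Section regular_conditional_distributions.
Local Open Scope ereal_scope.
Context {R : realType}.

(** A countable generating class, so that the exceptional null sets of its members
can be united. *)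
Definition rational_rays : set (set R) :=
  [set A | exists q : rat, A = `](ratr q)%R, +oo[%classic].

Lemma measurable_rational_rays : @measurable _ R = <<s rational_rays >>.
Proof.
apply/seteqP; split.
  rewrite [X in X `<=` _](RGenOInfty.measurableE R).
  apply: smallest_sub; first exact: smallest_sigma_algebra.
  move=> _ [s ->].
  pose F n := if (unpickle n : option rat) is Some q then
    (if (s < ratr q)%R then `](ratr q : R)%R, +oo[%classic else set0) else set0.
  rewrite (_ : `]s, +oo[%classic = \bigcup_n F n).
    apply: sigma_algebra_bigcup => n; rewrite /F.
    case: (unpickle n) => [q|]; last exact: sigma_algebra0.
    case: ifPn => _; last exact: sigma_algebra0.
    by apply: sub_sigma_algebra; exists q.
  apply/seteqP; split => x /=; rewrite ?in_itv/= ?andbT => sx.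
    have [q] := rat_in_itvoo sx; rewrite in_itv/= => /andP[sq qx].
    exists (pickle q); first by [].
    rewrite /F pickleK sq; change (x \in `](ratr q : R)%R, +oo[).
    by rewrite in_itv/= qx.
  case: sx => n _; rewrite /F; case: (unpickle n) => [q|]//.
  by case: ifPn => // sq /=; rewrite in_itv/= andbT; exact: lt_trans.
apply: smallest_sub; first exact: sigma_algebra_measurable.
by move=> _ [q ->]; exact: measurable_itv.
Qed.

Lemma eq_probability_rational_rays (m1 m2 : {measure set R -> \bar R}) :
  m1 setT < +oo ->
  (forall q : rat, m1 `](ratr q)%R, +oo[%classic = m2 `](ratr q)%R, +oo[%classic) ->
  forall B, measurable B -> m1 B = m2 B.
Proof.
move=> m1oo m12.
apply: (measure_unique rational_rays (fun k => `](ratr (- k%:R))%R, +oo[%classic)) => //.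
- exact: measurable_rational_rays.
- move=> _ _ [q ->] [r ->]; exists (Order.max q r).
  apply/seteqP; split => x /=; rewrite !in_itv/= !andbT; case: (leP q r) => qr.
  + by move=> [].
  + by move=> [].
  + by move=> h; split => //; apply: le_lt_trans h; rewrite ler_rat.
  + by move=> h; split => //; apply: lt_trans h; rewrite ltr_rat.
- by move=> k; eexists.
- apply/seteqP; split => // x _; exists (Num.trunc `|x|).+1 => //=.
  rewrite in_itv/= andbT rmorphN/= ratr_nat ltrNl; apply: le_lt_trans (truncnS_gt _).
  by rewrite -normrN ler_norm.
- by move=> _ [q ->].
- move=> k; apply: le_lt_trans m1oo; apply: le_measure; rewrite ?inE//.
Qed.

Context d (T : measurableType d) (P : probability T R).
Context d1 (T1 : measurableType d1) (X : T -> T1) (Y : T -> R).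
Hypothesis mX : measurable_fun setT X.

Lemma regular_cond_distribution_ae_eq (k1 k2 : R.-pker T1 ~> R) :
  regular_cond_distribution P X Y k1 -> regular_cond_distribution P X Y k2 ->
  {ae P, forall w B, measurable B -> k1 (X w) B = k2 (X w) B}.
Proof.
move=> h1 h2.
have k_le1 (k : R.-pker T1 ~> R) q B : measurable B -> k q B <= 1.
  move=> mB; rewrite -(@prob_kernel _ _ _ _ _ k q); apply: le_measure; rewrite ?inE//.
have onB B : measurable B -> {ae P, forall w, k1 (X w) B = k2 (X w) B}.
  move=> mB.
  have mk (k : R.-pker T1 ~> R) : measurable_fun setT (k ^~ B) by exact: measurable_kernel.
  have ik : (image_prob P mX).-integrable setT (k1 ^~ B).
    apply/integrableP; split => //.
    apply: (@le_lt_trans _ _ (\int[image_prob P mX]_q cst 1 q)).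
      apply: ge0_le_integral => //.
        by apply: measurableT_comp.
      by move=> q _; rewrite gee0_abs//; exact: k_le1.
    by rewrite integral_prob_cst ltry.
  have ae12 : ae_eq (image_prob P mX) setT (k1 ^~ B) (k2 ^~ B).
    apply: integral_ae_eq => // E _ mE.
    transitivity (P (X @^-1` E `&` Y @^-1` B)).
      rewrite (h1 _ _ mE mB); apply: (ge0_integral_image_prob_in P mX mE (mk k1)) => q.
      exact: measure_ge0.
    rewrite (h2 _ _ mE mB); apply/esym.
    by apply: (ge0_integral_image_prob_in P mX mE (mk k2)) => q; exact: measure_ge0.
  have := ae_image_prob ae12.
  by apply: filterS => w; exact.
pose r (k : nat) : rat := odflt 0%R (unpickle k).
have all_q : {ae P, forall w, forall k,
    k1 (X w) `](ratr (r k))%R, +oo[%classic = k2 (X w) `](ratr (r k))%R, +oo[%classic}.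
  by apply: ae_foralln => k; exact: onB.
apply: filterS all_q => w hw B mB.
apply: eq_probability_rational_rays => //.
  by rewrite prob_kernel ltry.
move=> q; have rK : r (pickle q) = q by rewrite /r pickleK.
by rewrite -rK; exact: hw.
Qed.

End regular_conditional_distributions.

(** * The law of the third side of a random triangle *)

Section chord_kernel.
Context {R : realType} (n : nat).
Local Open Scope ereal_scope.
Local Notation X := (n.-tuple R * n.-tuple R)%type.
Local Notation U := (@pair_cosine R n).

(** The third side of a triangle of sides [q.1] and [q.2], [u] being the cosine of
the exterior angle between them. *)
Definition chord (q : R * R) (u : R) : R :=
  Num.sqrt (q.1 ^+ 2 + q.2 ^+ 2 + 2 * q.1 * q.2 * u).

Lemma measurable_chord : measurable_fun setT (fun z : (R * R) * R => chord z.1 z.2).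
Proof.
apply: (measurableT_comp (f := @Num.sqrt R)).
  by apply: continuous_measurable_fun; exact: sqrt_continuous.
have m1 : measurable_fun setT (fun z : (R * R) * R => z.1.1).
  exact: (measurableT_comp measurable_fst measurable_fst).
have m2 : measurable_fun setT (fun z : (R * R) * R => z.1.2).
  exact: (measurableT_comp measurable_snd measurable_fst).
apply: measurable_funD; first by apply: measurable_funD; exact: measurable_funX.
by apply: measurable_funM => //; apply: measurable_funM => //; exact: measurable_funM.
Qed.

Lemma measurable_chord_cosine q : measurable_fun setT (fun w : X => chord q (U w)).
Proof.
apply: (measurableT_comp (f := chord q)); last exact: measurable_cosine.
exact: (measurableT_comp measurable_chord (pair1_measurable q)).
Qed.

Lemma enorm_tupleD (x y : n.-tuple R) :
  enorm (tupleD x y) = chord (enorm x, enorm y) (cosine x y).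
Proof.
rewrite /chord/= -(mulrA 2%R) -mulrA cosineE !sqr_enorm; congr Num.sqrt.
rewrite /sqnorm /dot mulr_sumr -!big_split/=; apply: eq_bigr => i _.
by rewrite tnth_mktuple; ring.
Qed.

Definition chord_kernel (q : R * R) : {measure set R -> \bar R} :=
  image_prob (gauss_pair n) (measurable_chord_cosine q).

Lemma chord_kernelE q B : measurable B ->
  chord_kernel q B = \int[gauss_pair n]_w (\1_B (chord q (U w)))%:E.
Proof.
move=> mB.
have -> : (fun w => (\1_B (chord q (U w)))%:E) =
    (fun w => (\1_((fun w => chord q (U w)) @^-1` B) w)%:E) :> (X -> \bar R) by [].
rewrite integral_indic ?setIT//.
by rewrite -[X in measurable X]setTI; exact: measurable_chord_cosine.
Qed.

Let mchordU : measurable_fun setT (fun z : (R * R) * X => chord z.1 (U z.2)).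
Proof.
apply: (measurableT_comp measurable_chord (g := fun z : (R * R) * X => (z.1, U z.2))).
apply: measurable_fun_pair => //.
exact: (measurableT_comp (@measurable_cosine R n)).
Qed.

Lemma measurable_chord_kernel B : measurable B ->
  measurable_fun setT (chord_kernel ^~ B).
Proof.
move=> mB.
rewrite (_ : chord_kernel ^~ B =
    fun q => \int[gauss_pair n]_w (\1_B (chord q (U w)))%:E); last first.
  by apply/funext => q; exact: chord_kernelE.
apply: (@measurable_integral_param _ _ _ _ _ (gauss_pair n)
  (fun q w => (\1_B (chord q (U w)))%:E)) => //.
apply/measurable_EFinP; have mI : measurable_fun setT (\1_B : R -> R) by [].
exact: (measurableT_comp mI mchordU).
Qed.

HB.instance Definition _ := isKernel.Build _ _ _ _ R chord_kernel measurable_chord_kernel.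

Let chord_kernel_prob q : chord_kernel q setT = 1.
Proof. exact: probability_setT. Qed.

HB.instance Definition _ := Kernel_isProbability.Build _ _ _ _ R chord_kernel chord_kernel_prob.

Lemma chord_kernel_mass q : chord_kernel q `[0%R, +oo[%classic = 1.
Proof.
have E : (fun w : X => chord q (U w)) @^-1` `[0%R, +oo[%classic = setT.
  by apply/seteqP; split => // w _ /=; rewrite in_itv/= sqrtr_ge0.
exact: (etrans (congr1 (gauss_pair n) E) (probability_setT _)).
Qed.

Lemma chord_kernel_compact x z : (0 <= x)%R -> (0 <= z)%R ->
  compactly_supported (chord_kernel (x, z)).
Proof.
move=> x0 z0; exists `[0%R, (x + z)%R]%classic; first exact: segment_compact.
have E : (fun w : X => chord (x, z) (U w)) @^-1` (~` `[0%R, (x + z)%R]%classic) = set0.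
  apply/seteqP; split => // w /=; apply; rewrite in_itv/= sqrtr_ge0/=.
  rewrite -[leRHS]ger0_norm ?addr_ge0// -sqrtr_sqr; apply: ler_wsqrtr.
  exact: (sqr_sum_cosine_le (fun w => cosine_le1 w.1 w.2) w x0 z0).
exact: (etrans (congr1 (gauss_pair n) E) (measure0 _)).
Qed.

Hypothesis n0 : (0 < n)%N.

Let c : R := (n%:R / 2)%R.

Let hc : (1 / 2 <= c)%R.
Proof. by rewrite ler_pM2r ?invr_gt0// ler1n. Qed.

Let U1 (w : X) : (`|U w| <= 1)%R. Proof. exact: cosine_le1. Qed.

Let mU : measurable_fun setT U. Proof. exact: measurable_cosine. Qed.

Lemma chord_kernel_bessel x z y : (0 <= x)%R -> (0 <= z)%R ->
  (bessel c (x * y) * bessel c (z * y) =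
   \int[chord_kernel (x, z)]_(xi in `[0, +oo[) bessel c (xi * y))%R.
Proof.
move=> x0 z0; rewrite /Rintegral.
have mb : measurable_fun setT (fun xi : R => (bessel c (xi * y))%:E).
  apply/measurable_EFinP; apply: (measurableT_comp (f := bessel c)).
    exact: measurable_bessel hc.
  exact: measurable_funM.
have m01 : measurable (`[0%R, +oo[%classic : set R) by exact: measurable_itv.
rewrite integral_mkcond integral_image_prob.
- rewrite -[LHS]/(fine (_%:E)).
  rewrite -(@bessel_product _ _ _ (gauss_pair n) U c mU U1 hc
    (fun m => cosine_even_moment m n0) (cosine_odd_moment n) x y z x0 z0).
  congr fine; apply: eq_integral => w _; rewrite patchE mem_set/=; last first.
    by rewrite in_itv/= sqrtr_ge0.
  by rewrite mulrC.
- have [h _] := measurable_restrictT (fun xi : R => (bessel c (xi * y))%:E) m01.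
  exact: (h (measurable_funTS mb)).
- rewrite (_ : _ \o _ = EFin \o (fun w => bessel c (chord (x, z) (U w) * y)%R)).
    apply: (@bounded_integrable _ _ _ (gauss_pair n) _ 1%R).
      apply: (measurableT_comp (f := fun xi : R => bessel c (xi * y)%R)).
        exact/measurable_EFinP.
      exact: measurable_chord_cosine.
    by move=> w; apply: (bessel_le1 mU U1 hc (fun m => cosine_even_moment m n0)).
  apply/funext => w /=; rewrite patchE mem_set//=.
  by rewrite in_itv/= sqrtr_ge0.
Qed.

Context d (T : measurableType d) (P : probability T R).
Context (N1 N2 : {RV P >-> n.-tuple R}).
Hypotheses (g1 : standard_normal_vector N1) (g2 : standard_normal_vector N2).
Hypothesis ind : independent2 N1 N2.

Lemma measurable_enorm_pair : measurable_fun setT (fun w => (enorm (N1 w), enorm (N2 w))).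
Proof.
by apply: measurable_fun_pair; apply: (measurableT_comp (@measurable_enorm R n)).
Qed.

(** Both sides are integrals over a pair of Gaussian vectors; [integral_bipolar]
replaces the cosine in the event R3 in B by that of an independent pair, whose
integral is the mass given to B by the kernel. *)
Lemma chord_kernel_regular :
  regular_cond_distribution P (fun w => (enorm (N1 w), enorm (N2 w)))
    (fun w => enorm (tupleD (N1 w) (N2 w))) chord_kernel.
Proof.
move=> A B mA mB.
have mR := measurable_enorm_pair.
set R12 := fun w => _.
have mRA : measurable (R12 @^-1` A) by rewrite -[X in measurable X]setTI; exact: mR.
have mIA : measurable_fun setT (\1_A : R * R -> R) by [].
have mIB : measurable_fun setT (\1_B : R -> R) by [].
pose F (q : R * R) (u : R) : \bar R := (\1_A q * \1_B (chord q u))%:E.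
have mF : measurable_fun setT (fun z : (R * R) * R => F z.1 z.2).
  apply/measurable_EFinP; apply: measurable_funM.
    exact: (measurableT_comp mIA).
  exact: (measurableT_comp mIB measurable_chord).
have F0 q u : 0 <= F q u by rewrite lee_fin mulr_ge0.
pose g (q : R * R) : \bar R := (\1_A q)%:E * chord_kernel q B.
have mg : measurable_fun setT g.
  apply: emeasurable_funM; last exact: measurable_chord_kernel.
  exact/measurable_EFinP.
have g0 q : 0 <= g q by rewrite mule_ge0// lee_fin.
have mNN : measurable_fun setT (fun z : X => (enorm z.1, enorm z.2)).
  by apply: measurable_fun_pair; exact: (measurableT_comp (@measurable_enorm R n)).
have gE q : \int[@gauss_tuple R n]_x \int[@gauss_tuple R n]_y F q (cosine x y) = g q.
  rewrite -(@tonelli_prod _ _ _ _ _ (gauss_tuple n) (gauss_tuple n) (fun x y => F q (cosine x y)))//; last first.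
    apply: (measurableT_comp mF (g := fun z : X => (q, U z))).
    exact: measurable_fun_pair.
  rewrite /g chord_kernelE// -ge0_integralZl//.
  by apply/measurable_EFinP; exact: (measurableT_comp mIB (measurable_chord_cosine q)).
transitivity (\int[P]_w g (R12 w)); last first.
  rewrite [RHS]integral_mkcond; apply: eq_integral => w _; rewrite patchE /g indicE.
  case: ifPn => [|] wA.
    by rewrite mem_set ?mul1e//; move: wA; rewrite inE.
  by rewrite memNset ?mul0e//; move: wA; rewrite notin_setE.
rewrite (@ge0_integral_independent_gauss _ _ _ P n N1 N2
  (fun x y => g (enorm x, enorm y)))//; last exact: (measurableT_comp mg mNN).
have -> : P (R12 @^-1` A `&` (fun w => enorm (tupleD (N1 w) (N2 w))) @^-1` B) =
    \int[P]_w F (enorm (N1 w), enorm (N2 w)) (cosine (N1 w) (N2 w)).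
  set S := (X in P X).
  have mS : measurable S.
    apply: measurableI => //.
    rewrite (_ : (fun w => _) = fun w => chord (R12 w) (cosine (N1 w) (N2 w))); last first.
      by apply/funext => w; rewrite enorm_tupleD.
    have mc : measurable_fun setT (fun w => chord (R12 w) (cosine (N1 w) (N2 w))).
      apply: (measurableT_comp measurable_chord (g := fun w => (R12 w, cosine (N1 w) (N2 w)))).
      apply: measurable_fun_pair => //.
      apply: (measurableT_comp mU (g := fun w => (N1 w, N2 w))).
      exact: measurable_fun_pair.
    by rewrite -[X in measurable X]setTI; exact: mc.
  rewrite -[X in P X]setIT -integral_indic//; apply: eq_integral => w _.
  rewrite /F -enorm_tupleD !indicE -natrM mulnb; congr (_%:R)%:E; congr nat_of_bool.
  apply/idP/andP => [|[]]; rewrite !inE; first by move=> [].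
  by move=> ? ?; split.
rewrite (@ge0_integral_independent_gauss _ _ _ P n N1 N2
  (fun x y => F (enorm x, enorm y) (cosine x y)))//; last first.
  apply: (measurableT_comp mF (g := fun z : X => ((enorm z.1, enorm z.2), U z))).
  exact: measurable_fun_pair.
transitivity (\int[@gauss_tuple R n]_x \int[@gauss_tuple R n]_y
    \int[@gauss_tuple R n]_x' \int[@gauss_tuple R n]_y'
      F (enorm x, enorm y) (cosine x' y')).
  exact: integral_bipolar.
by apply: eq_integral => x _; apply: eq_integral => y _; rewrite gE.
Qed.

End chord_kernel.

Unset Implicit Arguments.
Set Strict Implicit.

Theorem mainTheorem1 (R : realType) (p : nat) (hp : (1 <= p)%N)
    (d : measure_display) (T : measurableType d) (P : probability T R)
    (N1 N2 : {RV P >-> p.-tuple R})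
    (hN1 : standard_normal_vector N1) (hN2 : standard_normal_vector N2)
    (hind : independent2 N1 N2) :
  let nu : R := p%:R / 2 - 1 in
  let R1 : T -> R := fun w => enorm (N1 w) in
  let R2 : T -> R := fun w => enorm (N2 w) in
  let R3 : T -> R := fun w => enorm (tupleD (N1 w) (N2 w)) in
  let R12 : T -> R * R := fun w => (R1 w, R2 w) in
  (forall mu : R.-pker (R * R)%type ~> R,
     regular_cond_distribution P R12 R3 mu ->
     forall v : p.-tuple R,
       {ae P, forall w,
         sphBessel nu (enorm v * R1 w) * sphBessel nu (enorm v * R2 w) =
         \int[mu (R12 w)]_(xi in `[0, +oo[) sphBessel nu (enorm v * xi)})
  /\
  (exists tau : R.-pker (R * R)%type ~> R,
     (forall x z : R, 0 <= x -> 0 <= z ->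
        [/\ tau (x, z) `[0, +oo[%classic = 1%E,
            compactly_supported (tau (x, z)) &
            forall y : R, 0 <= y ->
              sphBessel nu (x * y) * sphBessel nu (z * y) =
              \int[tau (x, z)]_(xi in `[0, +oo[) sphBessel nu (xi * y)]) /\
     regular_cond_distribution P R12 R3 tau).
Proof.
move=> nu R1 R2 R3 R12.
have reg := chord_kernel_regular hN1 hN2 hind.
have product x z y : 0 <= x -> 0 <= z ->
    sphBessel nu (x * y) * sphBessel nu (z * y) =
    \int[chord_kernel p (x, z)]_(xi in `[0, +oo[) sphBessel nu (xi * y).
  move=> x0 z0; rewrite !sphBesselE// (chord_kernel_bessel hp y x0 z0).
  by congr (fine _); apply: eq_integral => xi _; rewrite sphBesselE.
split; last first.
  exists (chord_kernel p); split => // x z x0 z0; split.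
  - exact: chord_kernel_mass.
  - exact: chord_kernel_compact.
  - by move=> y _; exact: product.
move=> mu mu_reg v.
have := regular_cond_distribution_ae_eq (measurable_enorm_pair N1 N2) mu_reg reg.
apply: filterS => w mu_chord.
rewrite ![enorm v * _]mulrC product ?enorm_ge0//.
congr (fine _).
transitivity (\int[mu (R12 w)]_(xi in `[0%R, +oo[) (sphBessel nu (xi * enorm v))%:E)%E.
  by apply: eq_measure_integral => B mB _; apply/esym; exact: mu_chord.
by apply: eq_integral => xi _; rewrite mulrC.
Qed.
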